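(* Consider a system of $N$ qubits placed on the sites of a lattice, with a target Hamiltonian $H$ and an actual Hamiltonian $$H' = H + \sum_{i=1}^M g_i V_i,$$ where $M=\mathcal{O}(N)$, each $V_i$ is a local Hermitian operator with $\|V_i\|\le 1$, and $g_1,\dots,g_M$ are independent $\chi$-deformed Gaussian random variables with parameters $\delta>0$ and $\Gamma\in(0,+\infty]$. Suppose $\sqrt{N}t\delta\le\mathcal{O}(1)$. Then for any density matrix $\rho$ and observable $O$, with $O(t)=e^{iHt}Oe^{-iHt}$ and $O'(t)=e^{iH't}Oe^{-iH't}$, $$\big|\mathbb{E}_{\{g_i\}}[\mathrm{tr}[\rho O'(t)]] - \mathrm{tr}[\rho O(t)]\big| = \mathcal{O}(N\delta^2t^2\|O\|).$$
   Context: A random variable $g$ is a $\chi$-deformed Gaussian random variable (with parameters $\delta>0$, $\Gamma\in(0,+\infty]$) if $g=\chi(\theta)$ for some $\theta\sim\mathcal{N}(0,1)$, where $\chi:\mathbb{R}\to\mathbb{R}$ is a strictly monotonically increasing differentiable function with $|\mathrm{d}\chi(\theta)/\mathrm{d}\theta|\le\delta$ for all $\theta$, $\chi(0)=0$, $\lim_{\theta\to+\infty}\chi(\theta)=\Gamma$, $\lim_{\theta\to-\infty}\chi(\theta)=-\Gamma$, and $\mathbb{E}[\chi(\theta)]=0$. Independence of the $g_i$ means the underlying Gaussians $\theta_i$ are independent. $\|\cdot\|$ denotes the operator norm. The $\mathcal{O}(\cdot)$ notation hides constants independent of $N$, $t$, $\delta$, $\rho$, $O$. *)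

(* Defs.v *)
From HB Require Import structures.
From mathcomp Require Import all_boot all_order all_algebra.
From mathcomp Require Import all_classical all_reals all_analysis.
From mathcomp Require Import complex.

Set Implicit Arguments.
Unset Strict Implicit.
Unset Printing Implicit Defensive.

Import Order.TTheory GRing.Theory Num.Theory numFieldNormedType.Exports.
Local Open Scope classical_set_scope.
Local Open Scope ring_scope.
Local Open Scope complex_scope.

Section QDefs.
Variable R : realType.

(* Hilbert space of N qubits: basis indexed by 'I_(qdim N), with qdim N = #|{ffun 'I_N -> bool}| (= 2^N);
   the basis vector with index i is the computational basis state |cfg i>. *)
Definition qconf (N : nat) := {ffun 'I_N -> bool}.
Definition qdim (N : nat) : nat := #|qconf N|.
Definition cfg (N : nat) (i : 'I_(qdim N)) : qconf N := enum_val i.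

Definition adjm (m n : nat) (A : 'M[R[i]]_(m, n)) : 'M[R[i]]_(n, m) :=
  (map_mx Num.conj A)^T.

Definition is_hermitian (n : nat) (A : 'M[R[i]]_n) : Prop := adjm A = A.

Definition psd (n : nat) (A : 'M[R[i]]_n) : Prop :=
  is_hermitian A /\ forall v : 'cV[R[i]]_n, 0 <= (adjm v *m A *m v) 0 0.

Definition density_matrix (n : nat) (rho : 'M[R[i]]_n) : Prop :=
  psd rho /\ \tr rho = 1.

Definition cabs2 (z : R[i]) : R := complex.Re z ^+ 2 + complex.Im z ^+ 2.
Definition vnorm (n : nat) (v : 'cV[R[i]]_n) : R := Num.sqrt (\sum_i cabs2 (v i 0)).
Definition opnorm (n : nat) (A : 'M[R[i]]_n) : R :=
  sup [set vnorm (A *m v) | v in [set v : 'cV[R[i]]_n | vnorm v = 1]].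

Definition exp_partial (n : nat) (A : 'M[R[i]]_n) (K : nat) : 'M[R[i]]_n :=
  \sum_(k < K) ((k`!%:R : R[i])^-1 *: A ^+ k).
Definition mexp (n : nat) (A : 'M[R[i]]_n) : 'M[R[i]]_n :=
  \matrix_(i, j) ((limn (fun K => complex.Re (exp_partial A K i j)))
                  +i* (limn (fun K => complex.Im (exp_partial A K i j)))).

Definition heis (n : nat) (H O : 'M[R[i]]_n) (t : R) : 'M[R[i]]_n :=
  mexp (('i * t%:C) *: H) *m O *m mexp ((- ('i * t%:C)) *: H).

(* V acts on the qubits in S only, i.e. V = A_S (x) Id_{complement of S} *)
Definition supported_on (N : nat) (S : {set 'I_N}) (V : 'M[R[i]]_(qdim N)) : Prop :=
  (forall i j, ~ (forall q, q \notin S -> cfg i q = cfg j q) -> V i j = 0) /\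
  (forall i j i' j',
     (forall q, q \notin S -> cfg i q = cfg j q) ->
     (forall q, q \notin S -> cfg i' q = cfg j' q) ->
     (forall q, q \in S -> cfg i q = cfg i' q) ->
     (forall q, q \in S -> cfg j q = cfg j' q) ->
     V i j = V i' j').

Definition k_local (N k : nat) (V : 'M[R[i]]_(qdim N)) : Prop :=
  exists S : {set 'I_N}, (#|S| <= k)%N /\ supported_on S V.

Definition gauss_mean (f : R -> R) : R := Rintegral (normal_prob 0 1) setT f.

(* Expectation over M independent standard Gaussians theta_0, ..., theta_{M-1}
   (product measure, written as an iterated integral) *)
Fixpoint gauss_expect (M : nat) : (('I_M -> R) -> R) -> R :=
  match M as m return (('I_m -> R) -> R) -> R with
  | 0 => fun F => F (fun _ => 0)
  | M'.+1 => fun F =>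
      gauss_mean (fun th0 => gauss_expect (fun th : 'I_M' -> R =>
        F (fun i : 'I_M'.+1 => if unlift ord0 i is Some j then th j else th0)))
  end.

Definition gauss_expectC (M : nat) (F : ('I_M -> R) -> R[i]) : R[i] :=
  (gauss_expect (fun th => complex.Re (F th))) +i* (gauss_expect (fun th => complex.Im (F th))).

Definition chi_deformation (delta : R) (Gamma : \bar R) (chi : R -> R) : Prop :=
  [/\ (forall x y, x < y -> chi x < chi y),
      (forall x, derivable chi x 1),
      (forall x, `| derive1 chi x | <= delta)
    & chi 0 = 0] /\
  [/\ ((chi x)%:E @[x --> +oo] --> Gamma),
      ((chi x)%:E @[x --> -oo] --> (- Gamma)%E)
    & gauss_mean chi = 0].

End QDefs.

(* Main.v *)
(** Replace the couplings by zero one at a time.  Since [E g_j = 0] and [g_j] is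
    independent of the other couplings, the term of [tr (rho O'(t))] linear in
    [g_j] averages out, so each replacement costs at most
    [3 t^2 ||O|| E (g_j^2) = O(delta^2 t^2 ||O||)], and there are [O(N)] of them.

    The remainder bound comes from the approximation of [exp X] by
    [(1 + X / n)^n]: the telescoped difference of two such powers splits exactly
    into a part linear in the perturbation and a quadratic remainder, and for
    [X = i t H] with [H] Hermitian one has [||1 + X / n||^2 <= 1 + ||X||^2 / n^2],
    whose [n]-th power tends to [1], so that no unitarity of [exp X] is needed. *)

Require Import Defs.
From HB Require Import structures.
From mathcomp Require Import all_boot all_order all_algebra.
From mathcomp Require Import all_classical all_reals all_analysis.
From mathcomp Require Import complex measurable_realfun ring lra ssrAC.

Import Order.TTheory GRing.Theory Num.Theory numFieldNormedType.Exports.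
Local Open Scope ring_scope.
Local Open Scope complex_scope.

(** * Gaussian averages *)

Section GaussMean.
Context {R : realType}.
Local Notation mu := (@lebesgue_measure R).
Local Notation P := (normal_prob (0 : R) 1).

(** The obstacle is the slope of [tr (rho O'(t))] in a single coupling. At finite [n] it is an
    explicit trace, but its convergence as [n] grows would need a separate argument. The
    second-order estimate is therefore stated without a slope: for two increments [r] and [s] of one
    coupling, [r * (h s - h 0) - s * (h r - h 0)] no longer contains it, and the bound on this
    combination passes to the limit in [n].

    The constant 3 counts one quadratic remainder for each of the two exponentials around [O], plus
    the product of their first differences. The factor [delta^2] arises because each [chi] is
    [delta]-Lipschitz and vanishes at 0, so that [E (g_j^2)] is at most [delta^2] times the Gaussian
    second moment.

    The expectation is an iterated integral whose linearity and monotonicity require integrability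
    at every level. Boundedness together with a Lipschitz estimate passes from an integrand to its
    partial integrals, and supplies this. *)

Lemma Radon_Nikodym_normal_prob :
  ae_eq mu setT (Radon_Nikodym_SigmaFinite.f P mu) (EFin \o normal_pdf 0 1).
Proof.
have dom : P `<< mu := normal_prob_dominates 0 1.
(* Integrable functions with equal integrals over all measurable sets agree almost everywhere. This
   makes explicit the abstract density produced by the change of variables below. *)
apply: integral_ae_eq => //.
- exact: Radon_Nikodym_SigmaFinite.f_integrable.
- by apply/measurable_EFinP; exact: measurable_normal_pdf.
- by move=> E _ mE; rewrite -Radon_Nikodym_SigmaFinite.f_integral.
Qed.

(* [x ^+ 2 / 4 <= expR (x ^+ 2 / 4)], and the remaining Gaussian factor is the
   unnormalised density of variance 2. *)
Lemma integrable_sqr_normal : P.-integrable setT (EFin \o (fun x : R => x ^+ 2)).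
Proof.
have dom : P `<< mu := normal_prob_dominates 0 1.
have mx2 : measurable_fun setT (EFin \o (fun x : R => x ^+ 2)).
  by apply/measurable_EFinP; exact: measurable_funX.
apply/integrableP; split => //.
under eq_integral => x _ do rewrite /= ger0_norm ?sqr_ge0//.
rewrite -(Radon_Nikodym_SigmaFinite.change_of_variables dom)//; last first.
  by move=> x; rewrite lee_fin sqr_ge0.
have [s s0 s2] : exists2 s : R, s != 0 & s ^+ 2 = 2.
  by exists (Num.sqrt 2); rewrite ?sqr_sqrtr// gt_eqF// sqrtr_gt0.
(* The 4 comes from [x^2 / 4 <= exp (x^2 / 4)]; the quotient of peaks renormalises the remaining
   factor to the density of standard deviation [s]. *)
pose c : R := 4 * (normal_peak 1 / normal_peak s).
have c0 : 0 <= c by rewrite mulr_ge0// divr_ge0 ?normal_peak_ge0.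
have cpdf x : 0 <= c * normal_pdf 0 s x by exact/mulr_ge0/normal_pdf_ge0.
have /integrableP[_] := integrableZl measurableT c (integrable_normal_pdf 0 s).
apply: le_lt_trans.
apply: (@le_trans _ _ (\int[mu]_x (x ^+ 2 * normal_pdf 0 1 x)%:E)%E); last first.
- apply: ge0_le_integral => //.
  + by move=> x _; rewrite lee_fin mulr_ge0 ?sqr_ge0 ?normal_pdf_ge0.
  + apply/measurable_EFinP; apply: measurable_funM; first exact: measurable_funX.
    exact: measurable_normal_pdf.
  + apply: measurableT_comp => //; apply/measurable_EFinP; apply: measurable_funM => //.
    exact: measurable_normal_pdf.
  + move=> x _; rewrite /= lee_fin ger0_norm//.
    rewrite !normal_pdfE ?oner_eq0// /normal_fun.
    have ps := normal_peak_gt0 s0.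
    rewrite /c !mulrA divfK ?gt_eqF// mulrAC [leRHS]mulrAC.
    rewrite ler_wpM2r ?normal_peak_ge0//.
    rewrite subr0 s2 expr1n.
    have -> : - x ^+ 2 / (1 *+ 2) = - (x ^+ 2 / 4) + - (x ^+ 2 / 4) by field.
    have -> : - x ^+ 2 / (2 *+ 2) = - (x ^+ 2 / 4) by field.
    rewrite expRD mulrA ler_wpM2r ?expR_ge0//.
    rewrite expRN ler_pdivrMr ?expR_gt0//.
    rewrite mulrC -ler_pdivrMr//.
    by apply: le_trans (expR_ge1Dx _); rewrite lerDr.
rewrite le_eqVlt; apply/orP; left; apply/eqP; apply: ae_eq_integral => //.
- apply: emeasurable_funM => //.
  exact: measurable_int (Radon_Nikodym_SigmaFinite.f_integrable dom).
- apply/measurable_EFinP; apply: measurable_funM; first exact: measurable_funX.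
  exact: measurable_normal_pdf.
- apply: filterS Radon_Nikodym_normal_prob => x /(_ I) /= -> _.
  by rewrite EFinM.
Qed.

Lemma integrable_quadratic_growth (f : R -> R) (a b : R) :
  measurable_fun setT f -> (forall x, `|f x| <= a + b * x ^+ 2) ->
  P.-integrable setT (EFin \o f).
Proof.
move=> mf fab.
apply: (@le_integrable _ _ _ P setT measurableT (EFin \o f)
  (EFin \o (fun x => a + b * x ^+ 2))) => //.
- exact/measurable_EFinP.
- move=> x _ /=; rewrite lee_fin; exact: le_trans (fab x) (ler_norm _).
- exact: integrableD (finite_measure_integrable_cst P a measurableT)
    (integrableZl measurableT b integrable_sqr_normal).
Qed.

Lemma gauss_mean_cst (c : R) : gauss_mean (fun=> c) = c.
Proof. by rewrite /gauss_mean Rintegral_cst// [X in fine X](@probability_setT _ _ _ P) mulr1. Qed.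

Lemma gauss_meanD (f g : R -> R) :
  P.-integrable setT (EFin \o f) -> P.-integrable setT (EFin \o g) ->
  gauss_mean (fun x => f x + g x) = gauss_mean f + gauss_mean g.
Proof. exact: RintegralD. Qed.

Lemma gauss_meanB (f g : R -> R) :
  P.-integrable setT (EFin \o f) -> P.-integrable setT (EFin \o g) ->
  gauss_mean (fun x => f x - g x) = gauss_mean f - gauss_mean g.
Proof. exact: RintegralB. Qed.

Lemma gauss_meanZ (k : R) (f : R -> R) : P.-integrable setT (EFin \o f) ->
  gauss_mean (fun x => k * f x) = k * gauss_mean f.
Proof. exact: RintegralZl. Qed.

Lemma gauss_mean_le_norm (f g : R -> R) :
  P.-integrable setT (EFin \o f) -> P.-integrable setT (EFin \o g) ->
  (forall x, `|f x| <= g x) -> `|gauss_mean f| <= gauss_mean g.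
Proof.
move=> fi gi fg; apply: le_trans (le_normr_Rintegral _ fi) _ => //.
apply: le_Rintegral => //; exact: (integrable_norm fi).
Qed.

Lemma lipschitz_measurable (f : R -> R) (L : R) :
  (forall x y, `|f x - f y| <= L * `|x - y|) -> measurable_fun setT f.
Proof.
move=> fL; apply: continuous_measurable_fun => x.
apply/cvgrPdist_le => e e0.
have L0 : 0 < `|L| + 1 by rewrite ltr_wpDl.
near=> y.
apply: le_trans (fL x y) _.
apply: (@le_trans _ _ ((`|L| + 1) * `|x - y|)).
  by rewrite ler_wpM2r// (le_trans (ler_norm _))// lerDl.
rewrite mulrC -ler_pdivlMr//.
near: y; apply: cvgr_dist_le; last by rewrite divr_gt0.
exact: cvg_id.
Unshelve. all: by end_near. Qed.


Local Notation m2 := (gauss_mean (fun x : R => x ^+ 2)).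

(* The third hypothesis says that [h] is affine near [0] up to an error [c s^2];
   comparing two increments [r] and [s] eliminates the slope.  Integrating in
   [s = chi x] kills the term linear in [s], and [r] then tends to [0]. *)
Lemma gauss_mean_second_order (h chi : R -> R) (B L c delta : R) :
  (forall s, `|h s| <= B) ->
  (forall r s, `|h r - h s| <= L * `|r - s|) ->
  (forall r s, `|r * (h s - h 0) - s * (h r - h 0)| <=
     c * (`|r| * s ^+ 2 + `|s| * r ^+ 2)) ->
  0 <= L -> 0 <= c -> 0 <= delta ->
  (forall x y, `|chi x - chi y| <= delta * `|x - y|) ->
  chi 0 = 0 -> gauss_mean chi = 0 ->
  `|gauss_mean (h \o chi) - h 0| <= c * delta ^+ 2 * m2.
Proof.
move=> hB hL hc L0 c0 d0 chiL chi0 Echi.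
have chid x : `|chi x| <= delta * `|x|.
  by have := chiL x 0; rewrite chi0 !subr0.
have chid2 x : chi x ^+ 2 <= delta ^+ 2 * x ^+ 2.
  rewrite -exprMn -[leLHS]real_normK ?num_real// -[leRHS]real_normK ?num_real//.
  by rewrite ler_sqr ?nnegrE// normrM (ger0_norm d0).
(* Integrability is tested against quadratic growth, so the linear growth of [chi] is weakened to a
   quadratic one. *)
have absx x : `|x| <= 1 + x ^+ 2 :> R.
  by rewrite -(real_normK (num_real x)); have := normr_ge0 x; nra.
have ichi : P.-integrable setT (EFin \o chi).
  apply: (@integrable_quadratic_growth _ delta delta).
    exact: lipschitz_measurable chiL.
  by move=> x; rewrite (le_trans (chid x))// -{2}(mulr1 delta) -mulrDr ler_wpM2l.
have mh : measurable_fun setT (h \o chi).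
  apply: (@lipschitz_measurable _ (L * delta)) => x y /=.
  by rewrite (le_trans (hL _ _))// -mulrA ler_wpM2l.
have ih : P.-integrable setT (EFin \o (h \o chi)).
  apply: (@integrable_quadratic_growth _ B 0) => // x /=.
  by rewrite mul0r addr0.
have m20 : 0 <= m2 by apply: Rintegral_ge0 => x _; exact: sqr_ge0.
have key r : 0 < r -> `|gauss_mean (h \o chi) - h 0| <=
    c * delta ^+ 2 * m2 + r * (c * delta * (1 + m2)).
  move=> r0.
  pose k := h r - h 0.
  have irh : P.-integrable setT (EFin \o (fun x => r * (h \o chi) x)).
    exact: integrableZl ih.
  have ikc : P.-integrable setT (EFin \o (fun x => k * chi x)).
    exact: integrableZl ichi.
  have ic : P.-integrable setT (EFin \o cst (r * h 0)).
    exact: finite_measure_integrable_cst.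
  have irhc : P.-integrable setT (EFin \o (fun x => r * (h \o chi) x - r * h 0)).
    exact: integrableB irh ic.
  have iu : P.-integrable setT
      (EFin \o (fun x => (r * (h \o chi) x - r * h 0) - k * chi x)).
    exact: integrableB irhc ikc.
  have Eu : gauss_mean (fun x => (r * (h \o chi) x - r * h 0) - k * chi x) =
      r * (gauss_mean (h \o chi) - h 0).
    rewrite (gauss_meanB _ _ irhc ikc) (gauss_meanB _ _ irh ic) gauss_mean_cst.
    by rewrite (gauss_meanZ _ _ ih) (gauss_meanZ _ _ ichi) Echi mulr0 subr0 mulrBr.
  (* The error at [s = chi x], after [|chi x| <= delta (1 + x^2)] and [(chi x)^2 <= delta^2 x^2].
     Only the term [r delta^2 x^2] is of first order in [r]; it survives division by [r] as [r]
     tends to 0. *)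
  pose w (x : R) := c * (delta * r ^+ 2) + c * (r * delta ^+ 2 + delta * r ^+ 2) * x ^+ 2.
  have ic' (a : R) : P.-integrable setT (EFin \o cst a).
    exact: finite_measure_integrable_cst.
  have ix2 (a : R) : P.-integrable setT (EFin \o (fun x => a * x ^+ 2)).
    exact: integrableZl integrable_sqr_normal.
  have iw : P.-integrable setT (EFin \o w).
    exact: integrableD (ic' _) (ix2 _).
  have Ew : gauss_mean w = c * (delta * r ^+ 2) + c * (r * delta ^+ 2 + delta * r ^+ 2) * m2.
    rewrite (gauss_meanD _ _ (ic' _) (ix2 _)) gauss_mean_cst.
    by rewrite (gauss_meanZ _ _ integrable_sqr_normal).
  have : `|r * (gauss_mean (h \o chi) - h 0)| <= gauss_mean w.
    rewrite -Eu; apply: gauss_mean_le_norm => // x /=.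
    have -> : r * h (chi x) - r * h 0 - k * chi x =
        r * (h (chi x) - h 0) - chi x * (h r - h 0) by rewrite /k; ring.
    apply: le_trans (hc _ _) _.
    rewrite /w -mulrA -mulrDr ler_wpM2l// (gtr0_norm r0).
    have b1 : `|chi x| * r ^+ 2 <= delta * (1 + x ^+ 2) * r ^+ 2.
      by rewrite ler_wpM2r ?sqr_ge0// (le_trans (chid x))// ler_wpM2l.
    have b2 : r * chi x ^+ 2 <= r * (delta ^+ 2 * x ^+ 2).
      by rewrite ler_wpM2l ?(ltW r0).
    by apply: le_trans (lerD b2 b1) _; rewrite le_eqVlt; apply/orP; left; apply/eqP; ring.
  rewrite Ew normrM (gtr0_norm r0) => H.
  rewrite -(ler_pM2l r0) (le_trans H)// le_eqVlt; apply/orP; left.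
  by apply/eqP; ring.
apply/ler_addgt0Pr => e e0.
pose z := c * delta * (1 + m2).
have z0 : 0 <= z by rewrite /z !mulr_ge0// addr_ge0.
(* With this [r] the excess [r * z] is at most [e]; the added 1 keeps the denominator positive when
   [z = 0]. *)
apply: le_trans (key (e / (1 + z)) _) _; first by rewrite divr_gt0// ltr_wpDr.
rewrite lerD2l -/z mulrAC ler_pdivrMr ?ltr_wpDr//.
by rewrite ler_wpM2l ?(ltW e0)// lerDr.
Qed.

(** * Iterated averages over independent couplings *)

Definition ocons {M : nat} (x : R) (th : 'I_M -> R) : 'I_M.+1 -> R :=
  fun i => if unlift ord0 i is Some j then th j else x.

Definition upd {M : nat} (g : 'I_M -> R) (j : 'I_M) (s : R) : 'I_M -> R :=
  fun i => if i == j then s else g i.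

Lemma ocons0 {M : nat} x (th : 'I_M -> R) : ocons x th ord0 = x.
Proof. by rewrite /ocons unlift_none. Qed.

Lemma oconsS {M : nat} x (th : 'I_M -> R) j : ocons x th (lift ord0 j) = th j.
Proof. by rewrite /ocons liftK. Qed.

Lemma upd_oconsS {M : nat} x (th : 'I_M -> R) j s :
  upd (ocons x th) (lift ord0 j) s = ocons x (upd th j s).
Proof.
apply/funext => i; case: (unliftP ord0 i) => [i'|] ->.
  by rewrite /upd !oconsS (inj_eq (@lift_inj _ _)).
by rewrite /upd !ocons0 (negbTE (neq_lift _ _)).
Qed.

Lemma upd_ocons0 {M : nat} x (th : 'I_M -> R) s :
  upd (ocons x th) ord0 s = ocons s th.
Proof.
apply/funext => i; case: (unliftP ord0 i) => [i'|] ->.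
  by rewrite /upd !oconsS eq_sym (negbTE (neq_lift _ _)).
by rewrite /upd !ocons0 eqxx.
Qed.

(** The l1 distance suits both ends: freezing a coordinate preserves the constants, and changing the
    couplings moves the Hamiltonian by at most this distance in operator norm, since
    [||V_m|| <= 1]. *)
Definition bounded_lipschitz {M : nat} (B L : R) (F : ('I_M -> R) -> R) :=
  (forall th, `|F th| <= B) /\
  (forall th th', `|F th - F th'| <= L * \sum_i `|th i - th' i|).

Lemma bounded_lipschitz_ocons {M : nat} B L (F : ('I_M.+1 -> R) -> R) x :
  bounded_lipschitz B L F -> bounded_lipschitz B L (fun th => F (ocons x th)).
Proof.
move=> [FB FL]; split=> // th th'; apply: le_trans (FL _ _) _.
rewrite big_ord_recl !ocons0 subrr normr0 add0r le_eqVlt; apply/orP; left.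
by apply/eqP; congr (_ * _); apply: eq_bigr => i _; rewrite !oconsS.
Qed.

Lemma bounded_lipschitz_head {M : nat} B L (F : ('I_M.+1 -> R) -> R) x y th :
  bounded_lipschitz B L F ->
  `|F (ocons x th) - F (ocons y th)| <= L * `|x - y|.
Proof.
move=> [_ /(_ (ocons x th) (ocons y th)) /le_trans]; apply.
rewrite big_ord_recl !ocons0 big1 ?addr0// => i _.
by rewrite !oconsS subrr normr0.
Qed.

(** True by conversion: [ocons] repeats the function built in the recursive clause of
    [gauss_expect]. *)
Lemma gauss_expectS {M : nat} (F : ('I_M.+1 -> R) -> R) :
  gauss_expect F = gauss_mean (fun x => gauss_expect (fun th => F (ocons x th))).
Proof. by []. Qed.

(** The induction needs both claims at once. The first bounds each partial integral; the second,
    applied to two values of the head, makes it Lipschitz and hence measurable. Together they give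
    the integrability required by the outer integral. *)
Lemma gauss_expect_bounded_close (M : nat) (B L : R) (F : ('I_M -> R) -> R) :
  bounded_lipschitz B L F ->
  `|gauss_expect F| <= B /\
  forall B' L' d F', bounded_lipschitz B' L' F' ->
    (forall th, `|F th - F' th| <= d) ->
    `|gauss_expect F - gauss_expect F'| <= d.
Proof.
elim: M B L F => [|M IH] B L F FBL.
  by split=> [|B' L' d F' _ Fd]; [exact: FBL.1|exact: Fd].
have integrable_slice B1 L1 G : bounded_lipschitz B1 L1 G ->
    P.-integrable setT (EFin \o (fun x => gauss_expect (fun th => G (@ocons M x th)))).
  move=> GBL.
  apply: (@integrable_quadratic_growth _ B1 0); last first.
    move=> x; rewrite mul0r addr0.
    by have [] := IH _ _ _ (bounded_lipschitz_ocons _ _ _ x GBL).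
  apply: (@lipschitz_measurable _ L1) => x y.
  have [_ H] := IH _ _ _ (bounded_lipschitz_ocons _ _ _ x GBL).
  apply: H (bounded_lipschitz_ocons _ _ _ y GBL) _ => th.
  exact: bounded_lipschitz_head GBL.
have iF := integrable_slice _ _ _ FBL.
have icst (a : R) : P.-integrable setT (EFin \o cst a).
  exact: finite_measure_integrable_cst.
split=> [|B' L' d F' FBL' Fd].
  rewrite gauss_expectS -[leRHS]gauss_mean_cst.
  apply: gauss_mean_le_norm => //; first exact: icst.
  by move=> x; have [] := IH _ _ _ (bounded_lipschitz_ocons _ _ _ x FBL).
have iF' := integrable_slice _ _ _ FBL'.
rewrite !gauss_expectS -gauss_meanB//.
rewrite -[leRHS]gauss_mean_cst.
apply: gauss_mean_le_norm; [exact: integrableB iF iF'|exact: icst|] => x.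
have [_ H] := IH _ _ _ (bounded_lipschitz_ocons _ _ _ x FBL).
exact: H (bounded_lipschitz_ocons _ _ _ x FBL') _.
Qed.

(** Since the hypothesis holds at every configuration [g], the first coupling may be frozen at
    [chi ord0 x]. Zeroing the other couplings then costs the same for every [x], so no integrals are
    exchanged, and a function of the first coupling alone remains. *)
Lemma gauss_expect_second_order (M : nat) (B L c delta : R) (chi : 'I_M -> R -> R)
    (G : ('I_M -> R) -> R) :
  bounded_lipschitz B L G ->
  (forall g j r s, `|r * (G (upd g j s) - G (upd g j 0)) -
                     s * (G (upd g j r) - G (upd g j 0))| <=
     c * (`|r| * s ^+ 2 + `|s| * r ^+ 2)) ->
  0 <= L -> 0 <= c -> 0 <= delta ->
  (forall j x y, `|chi j x - chi j y| <= delta * `|x - y|) ->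
  (forall j, chi j 0 = 0) -> (forall j, gauss_mean (chi j) = 0) ->
  `|gauss_expect (fun th => G (fun j => chi j (th j))) - G (fun=> 0)| <=
    M%:R * (c * delta ^+ 2 * m2).
Proof.
move=> GBL Gc L0 c0 d0; elim: M chi G GBL Gc => [|M IH] chi G GBL Gc chiL chi0 Echi.
  rewrite mul0r /= (_ : (fun j => _) = (fun=> 0)) ?subrr ?normr0//.
  by apply/funext; case.
pose chi' j := chi (lift ord0 j).
have chi_ocons x (th : 'I_M -> R) : (fun j => chi j (ocons x th j)) =
    ocons (chi ord0 x) (fun j => chi' j (th j)).
  apply/funext => i; case: (unliftP ord0 i) => [i'|] ->.
    by rewrite !oconsS.
  by rewrite !ocons0.
have ocons00 : ocons 0 (fun=> 0) = (fun=> 0) :> ('I_M.+1 -> R).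
  by apply/funext => i; rewrite /ocons; case: unlift.
pose h x := G (ocons x (fun=> 0)).
have hG : G (fun=> 0) = h 0 by rewrite /h ocons00.
have hL r s : `|h r - h s| <= L * `|r - s| by exact: bounded_lipschitz_head GBL.
have head : `|gauss_mean (h \o chi ord0) - h 0| <= c * delta ^+ 2 * m2.
  apply: (gauss_mean_second_order _ _ B L) => //.
    by move=> s; exact: GBL.1.
  by move=> r s; have := Gc (fun=> 0) ord0 r s; rewrite -ocons00 !upd_ocons0.
pose H x := gauss_expect (fun th => G (ocons (chi ord0 x) (fun j => chi' j (th j)))).
have HE x : H x = gauss_expect (fun th => (fun th' => G (fun j => chi j (th' j))) (ocons x th)).
  by congr gauss_expect; apply/funext => th; rewrite chi_ocons.
have tail x : `|H x - h (chi ord0 x)| <= M%:R * (c * delta ^+ 2 * m2).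
  apply: (IH chi' (fun g => G (ocons (chi ord0 x) g))) => //.
  - exact: bounded_lipschitz_ocons.
  - by move=> g j r s; rewrite -!upd_oconsS.
  - by move=> j; exact: chiL.
  - by move=> j; exact: chi0.
  - by move=> j; exact: Echi.
have BL' : bounded_lipschitz B (L * delta) (fun th => G (fun j => chi j (th j))).
  split=> [th|th th']; first exact: GBL.1.
  apply: le_trans (GBL.2 _ _) _.
  by rewrite -mulrA ler_wpM2l// mulr_sumr ler_sum.
have iH : P.-integrable setT (EFin \o H).
  apply: (@integrable_quadratic_growth _ B 0).
    apply: (@lipschitz_measurable _ (L * delta)) => x y.
    rewrite !HE.
    have [_ K] := gauss_expect_bounded_close _ _ _ _ (bounded_lipschitz_ocons _ _ _ x BL').
    apply: K (bounded_lipschitz_ocons _ _ _ y BL') _ => th.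
    exact: bounded_lipschitz_head BL'.
  move=> x; rewrite mul0r addr0 HE.
  by have [] := gauss_expect_bounded_close _ _ _ _ (bounded_lipschitz_ocons _ _ _ x BL').
have ih : P.-integrable setT (EFin \o (h \o chi ord0)).
  apply: (@integrable_quadratic_growth _ B 0).
    apply: (@lipschitz_measurable _ (L * delta)) => x y /=.
    by apply: le_trans (hL _ _) _; rewrite -mulrA ler_wpM2l.
  by move=> x; rewrite mul0r addr0; exact: GBL.1.
have EH : gauss_expect (fun th => G (fun j => chi j (th j))) = gauss_mean H.
  by rewrite gauss_expectS; congr gauss_mean; apply/funext => x; rewrite HE.
rewrite EH hG -(subrKA (gauss_mean (h \o chi ord0))) -natr1 mulrDl mul1r.
apply: le_trans (ler_normD _ _) _; apply: lerD; last exact: head.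
rewrite -gauss_meanB// -[leRHS]gauss_mean_cst.
apply: gauss_mean_le_norm => //; first exact: integrableB iH ih.
exact: finite_measure_integrable_cst.
Qed.

End GaussMean.

Lemma chi_deformation_lipschitz {R : realType} (delta : R) Gamma chi :
  chi_deformation delta Gamma chi ->
  forall x y : R, `|chi x - chi y| <= delta * `|x - y|.
Proof.
move=> [[_ dchi chid _] _].
have key x y : x <= y -> `|chi y - chi x| <= delta * `|y - x|.
  move=> xy; have [| |c _ ->] := @MVT_segment R chi (fun z => derive1 chi z) _ _ xy.
  - by move=> z _; rewrite derive1E; exact: derivableP.
  - apply: continuous_subspaceT => z.
    by apply: differentiable_continuous; exact/derivable1_diffP.
  - by rewrite normrM ler_wpM2r.
move=> x y; have [xy|yx] := leP x y; last exact/key/ltW.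
by rewrite distrC (distrC x) key.
Qed.

(** * Operator norm bounds *)

Section ComplexModulus.
Context {R : realType}.
Implicit Types z w : R[i].

(** The norm of [R[i]] takes values in [R[i]]; suprema, square roots and real limits call for a
    modulus in [R]. *)
Definition cmod z : R := Num.sqrt (cabs2 z).

Lemma cmodE z : `|z| = (cmod z)%:C.
Proof. by rewrite normc_def. Qed.

Lemma cmod_ge0 z : 0 <= cmod z. Proof. exact: sqrtr_ge0. Qed.

Lemma cabs2_ge0 z : 0 <= cabs2 z. Proof. by rewrite addr_ge0 ?sqr_ge0. Qed.

Lemma cmod_sqr z : cmod z ^+ 2 = cabs2 z.
Proof. by rewrite sqr_sqrtr ?cabs2_ge0. Qed.

Lemma realCD (x y : R) : (x + y)%:C = x%:C + y%:C. Proof. exact: rmorphD. Qed.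

Lemma realCM (x y : R) : (x * y)%:C = x%:C * y%:C. Proof. exact: rmorphM. Qed.

Lemma realC_sum (I : Type) (s : seq I) (P : pred I) (F : I -> R) :
  (\sum_(i <- s | P i) F i)%:C = \sum_(i <- s | P i) (F i)%:C.
Proof. exact: rmorph_sum. Qed.

Lemma cmodM z w : cmod (z * w) = cmod z * cmod w.
Proof. by have /complexI : (cmod (z * w))%:C = (cmod z * cmod w)%:C by rewrite realCM -!cmodE normrM. Qed.

Lemma cmodD z w : cmod (z + w) <= cmod z + cmod w.
Proof. by rewrite -lecR realCD -!cmodE ler_normD. Qed.

Lemma cmodN z : cmod (- z) = cmod z.
Proof. by case: z => a b; rewrite /cmod /cabs2 /= !sqrrN. Qed.

Lemma cmodB z w : cmod (z - w) <= cmod z + cmod w.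
Proof. by rewrite -(cmodN w) cmodD. Qed.

Lemma cmod_sum (I : Type) (s : seq I) (P : pred I) (F : I -> R[i]) :
  cmod (\sum_(i <- s | P i) F i) <= \sum_(i <- s | P i) cmod (F i).
Proof.
rewrite -lecR realC_sum -cmodE (le_trans (ler_norm_sum _ _ _))//.
by rewrite ler_sum// => i _; rewrite cmodE.
Qed.

Lemma cmod_real (x : R) : cmod x%:C = `|x|.
Proof. by rewrite /cmod /cabs2 /= expr0n addr0 sqrtr_sqr. Qed.

Lemma cmod_conj z : cmod (Num.conj z) = cmod z.
Proof. by apply: (@complexI R); rewrite -!cmodE norm_conjC. Qed.

Lemma cmodi : cmod 'i = 1.
Proof. by rewrite /cmod /cabs2 /= expr0n add0r expr1n sqrtr1. Qed.

Lemma Re_le_cmod z : `|complex.Re z| <= cmod z.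
Proof. by rewrite -sqrtr_sqr ler_wsqrtr// lerDl sqr_ge0. Qed.

Lemma Im_le_cmod z : `|complex.Im z| <= cmod z.
Proof. by rewrite -sqrtr_sqr ler_wsqrtr// lerDr sqr_ge0. Qed.

Lemma cmod_le_ReIm z : cmod z <= `|complex.Re z| + `|complex.Im z|.
Proof.
rewrite -ler_sqr ?nnegrE ?cmod_ge0 ?addr_ge0// cmod_sqr sqrrD !real_normK ?num_real//.
by rewrite addrAC lerDl mulrn_wge0// mulr_ge0.
Qed.

Lemma cauchy_schwarz_sum (I : finType) (a b : I -> R) :
  \sum_i a i * b i <= Num.sqrt (\sum_i a i ^+ 2) * Num.sqrt (\sum_i b i ^+ 2).
Proof.
set A := \sum_i a i ^+ 2; set B := \sum_i b i ^+ 2; set D := \sum_i a i * b i.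
have A0 : 0 <= A by apply: sumr_ge0 => i _; exact: sqr_ge0.
have B0 : 0 <= B by apply: sumr_ge0 => i _; exact: sqr_ge0.
(* Expand the sum of the squares of [A * b i - D * a i]. The factor [A] is cancelled when positive;
   if [A = 0], every [a i] vanishes. *)
have H : 0 <= A * (A * B - D ^+ 2).
  have : 0 <= \sum_i (A * b i - D * a i) ^+ 2 by apply: sumr_ge0 => i _; exact: sqr_ge0.
  suff -> : \sum_i (A * b i - D * a i) ^+ 2 = A * (A * B - D ^+ 2) by [].
  rewrite (eq_bigr (fun i => A ^+ 2 * b i ^+ 2 - (A * D *+ 2) * (a i * b i) + D ^+ 2 * a i ^+ 2)); last first.
    by move=> i _; ring.
  by rewrite big_split /= sumrB -!mulr_sumr -/A -/B -/D; ring.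
rewrite -sqrtrM// (le_trans (ler_norm _))// -sqrtr_sqr ler_wsqrtr//.
move: A0; rewrite le_eqVlt => /predU1P[A0|A0]; last first.
  by move: H; rewrite pmulr_rge0// subr_ge0.
suff -> : D = 0 by rewrite expr0n -A0 mul0r.
rewrite /D big1// => i _.
have /eqP : a i ^+ 2 = 0.
  apply/eqP; rewrite eq_le sqr_ge0 andbT A0 /A (bigD1 i)//= lerDl.
  by apply: sumr_ge0 => j _; exact: sqr_ge0.
by rewrite sqrf_eq0 => /eqP ->; rewrite mul0r.
Qed.

End ComplexModulus.

(** * Euclidean norm, inner product and operator bounds *)

Section VectorNorm.
Context {R : realType}.
Local Notation C := R[i].

Lemma adjmM {m n p} (A : 'M[C]_(m, n)) (B : 'M[C]_(n, p)) :
  adjm (A *m B) = adjm B *m adjm A.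
Proof. by rewrite /adjm map_mxM trmx_mul. Qed.

Lemma adjmK {m n} (A : 'M[C]_(m, n)) : adjm (adjm A) = A.
Proof. by apply/matrixP => i j; rewrite !mxE /= conjCK. Qed.

Section Vec.
Context {n : nat}.
Local Open Scope ring_scope.
Implicit Types (u v : 'cV[C]_n) (A B : 'M[C]_n).

Lemma vnorm_ge0 v : 0 <= vnorm v. Proof. exact: sqrtr_ge0. Qed.

Lemma vnorm_sqr v : vnorm v ^+ 2 = \sum_i cabs2 (v i 0).
Proof. by rewrite sqr_sqrtr// sumr_ge0// => i _; exact: cabs2_ge0. Qed.

Lemma vnormE v : vnorm v = Num.sqrt (\sum_i cmod (v i 0) ^+ 2).
Proof. by congr Num.sqrt; apply: eq_bigr => i _; rewrite cmod_sqr. Qed.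

Lemma vnormZ (a : C) v : vnorm (a *: v) = cmod a * vnorm v.
Proof.
rewrite !vnormE -[cmod a]ger0_norm ?cmod_ge0// -sqrtr_sqr -sqrtrM ?sqr_ge0//.
by rewrite mulr_sumr; congr Num.sqrt; apply: eq_bigr => i _; rewrite mxE cmodM exprMn.
Qed.

Lemma vnormD u v : vnorm (u + v) <= vnorm u + vnorm v.
Proof.
rewrite -ler_sqr ?nnegrE ?addr_ge0 ?vnorm_ge0// sqrrD 3!vnorm_sqr.
have H : \sum_i cmod (u i 0) * cmod (v i 0) <= vnorm u * vnorm v.
  by rewrite !vnormE cauchy_schwarz_sum.
apply: (@le_trans _ _ (\sum_i (cabs2 (u i 0) + (cmod (u i 0) * cmod (v i 0)) *+ 2 + cabs2 (v i 0)))).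
  apply: ler_sum => i _; rewrite mxE -!cmod_sqr -sqrrD.
  by rewrite ler_sqr ?nnegrE ?addr_ge0 ?cmod_ge0// cmodD.
by rewrite !big_split /= lerD2r lerD2l mulr2n lerD.
Qed.

Lemma cmod_le_vnorm v i : cmod (v i 0) <= vnorm v.
Proof.
rewrite -ler_sqr ?nnegrE ?cmod_ge0 ?vnorm_ge0// vnorm_sqr cmod_sqr (bigD1 i)//=.
by rewrite lerDl sumr_ge0// => j _; exact: cabs2_ge0.
Qed.

Lemma vnorm_eq0 v : vnorm v = 0 -> v = 0.
Proof.
move=> v0; apply/colP => i; rewrite mxE.
have : cmod (v i 0) = 0.
  by apply/eqP; rewrite eq_le cmod_ge0 andbT -v0 cmod_le_vnorm.
by move=> vi0; apply/eqP; rewrite -normr_eq0 cmodE vi0.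
Qed.

Definition dotc u v : C := (adjm u *m v) 0 0.

Lemma dotcE u v : dotc u v = \sum_i Num.conj (u i 0) * v i 0.
Proof. by rewrite /dotc mxE; apply: eq_bigr => i _; rewrite !mxE. Qed.

Lemma cmod_dotc u v : cmod (dotc u v) <= vnorm u * vnorm v.
Proof.
rewrite dotcE (le_trans (cmod_sum _ _ _ _))// !vnormE.
under eq_bigr do rewrite cmodM cmod_conj.
exact: cauchy_schwarz_sum.
Qed.

Lemma dotcvv v : dotc v v = (vnorm v ^+ 2)%:C.
Proof.
rewrite dotcE vnorm_sqr rmorph_sum; apply: eq_bigr => i _.
by rewrite mulrC -normCK cmodE -rmorphXn cmod_sqr.
Qed.

Lemma dotcA A u v : dotc u (A *m v) = dotc (adjm A *m u) v.
Proof. by rewrite /dotc mulmxA adjmM adjmK. Qed.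

(** Working with this inequality keeps suprema out of the calculus of sums, products and powers;
    [mxbound_opnorm] is the bridge from [opnorm]. *)
Definition mxbound A (c : R) := forall v, vnorm (A *m v) <= c * vnorm v.

Lemma mxbound_le A a b : a <= b -> mxbound A a -> mxbound A b.
Proof. by move=> ab Aa v; rewrite (le_trans (Aa v))// ler_wpM2r ?vnorm_ge0. Qed.

Lemma mxboundM A B a b : 0 <= a -> mxbound A a -> mxbound B b ->
  mxbound (A * B) (a * b).
Proof.
by move=> a0 Aa Bb v; rewrite -mulmxE -mulmxA (le_trans (Aa _))// -mulrA ler_wpM2l.
Qed.

Lemma mxboundD A B a b : mxbound A a -> mxbound B b -> mxbound (A + B) (a + b).
Proof.
by move=> Aa Bb v; rewrite mulmxDl (le_trans (vnormD _ _))// mulrDl lerD.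
Qed.

Lemma mxboundZ A a z : mxbound A a -> mxbound (z *: A) (cmod z * a).
Proof.
by move=> Aa v; rewrite -scalemxAl vnormZ -mulrA ler_wpM2l ?cmod_ge0.
Qed.

Lemma mxbound0 : mxbound (0 : 'M[C]_n) 0.
Proof.
move=> v; rewrite mul0mx mul0r -(scale0r v) vnormZ.
by rewrite (cmod_real 0) normr0 mul0r.
Qed.

Lemma mxbound1 : mxbound (1 : 'M[C]_n) 1.
Proof. by move=> v; rewrite mul1mx mul1r. Qed.

Lemma mxbound_sum m (F : 'I_m -> 'M[C]_n) (c : 'I_m -> R) :
  (forall i, mxbound (F i) (c i)) -> mxbound (\sum_i F i) (\sum_i c i).
Proof.
by move=> Fc; elim/big_ind2: _ => [|? ? ? ? ? ?|i _] //; [exact: mxbound0|exact: mxboundD].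
Qed.

Lemma mxboundX A a k : 0 <= a -> mxbound A a -> mxbound (A ^+ k) (a ^+ k).
Proof.
move=> a0 Aa; elim: k => [|k IH]; first exact: mxbound1.
by rewrite !exprS; exact: mxboundM.
Qed.

(** A qualitative bound suffices: besides making the supremum in [opnorm] finite, it enters only
    error terms that vanish in the limit of powers. *)
Lemma mxbound_exists A : exists2 c, 0 <= c & mxbound A c.
Proof.
pose c := \sum_j vnorm (col j A); exists c.
  by apply: sumr_ge0 => j _; exact: vnorm_ge0.
move=> v.
have -> : A *m v = \sum_j v j 0 *: col j A.
  apply/colP => i; rewrite mxE summxE; apply: eq_bigr => j _.
  by rewrite !mxE mulrC.
apply: (@le_trans _ _ (\sum_j vnorm (v j 0 *: col j A))).
  elim/big_ind2: _ => // [|x1 x2 y1 y2 H1 H2].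
    by rewrite -(scale0r v) vnormZ (cmod_real 0) normr0 mul0r.
  by rewrite (le_trans (vnormD _ _))// lerD.
rewrite mulr_suml ler_sum// => j _.
by rewrite vnormZ mulrC ler_wpM2l ?vnorm_ge0// cmod_le_vnorm.
Qed.

Lemma mxbound_opnorm A : mxbound A (opnorm A).
Proof.
move=> v; have [c c0 Ac] := mxbound_exists A.
have [v0|v0] := eqVneq (vnorm v) 0.
  by rewrite v0 mulr0 (vnorm_eq0 _ v0) mulmx0 -(vnorm_eq0 _ v0) v0.
have vgt0 : 0 < vnorm v by rewrite lt_neqAle eq_sym v0 vnorm_ge0.
rewrite -ler_pdivrMr//.
have cV : cmod (vnorm v)^-1%:C = (vnorm v)^-1.
  by rewrite cmod_real ger0_norm// invr_ge0 vnorm_ge0.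
have -> : vnorm (A *m v) / vnorm v = vnorm (A *m ((vnorm v)^-1%:C *: v)).
  by rewrite -scalemxAr vnormZ cV mulrC.
apply: ub_le_sup.
  by exists c => _ [w /= w1 <-]; rewrite (le_trans (Ac w))// w1 mulr1.
by exists ((vnorm v)^-1%:C *: v) => //=; rewrite vnormZ cV mulVf.
Qed.

Lemma opnorm_ge0 A : 0 <= opnorm A.
Proof.
have [v [v1|v0]] : exists v : 'cV[C]_n, vnorm v = 1 \/ forall w : 'cV[C]_n, vnorm w <> 1.
  have [[v v1]|no] := pselect (exists v : 'cV[C]_n, vnorm v = 1).
    by exists v; left.
  by exists 0; right => w w1; apply: no; exists w.
- by have := mxbound_opnorm A v; rewrite v1 mulr1; apply: le_trans; exact: vnorm_ge0.
(* In dimension zero there is no unit vector, and the supremum of the empty set is 0. *)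
- by rewrite /opnorm (_ : [set _ | _ in _]%classic = set0) ?sup0// -subset0 => x [w /v0].
Qed.

Lemma mxbound_entry A c i j : mxbound A c -> cmod (A i j) <= c.
Proof.
move=> Ac; have := Ac (delta_mx j 0).
have -> : vnorm (delta_mx j 0 : 'cV[C]_n) = 1.
  rewrite vnormE (bigD1 j)//= big1 ?addr0.
    by rewrite mxE !eqxx (cmod_real 1) normr1 expr1n sqrtr1.
  by move=> k kj; rewrite mxE (negbTE kj) (cmod_real 0) normr0 expr0n.
rewrite mulr1 -colE; apply: le_trans.
by rewrite (le_trans _ (cmod_le_vnorm _ i))// mxE.
Qed.

(* In [||v + i e A v||^2] the two cross terms cancel because [<v, A v>] is real. *)
Lemma mxbound_1iA A (a e : R) : 0 <= a -> is_hermitian A -> mxbound A a ->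
  mxbound (1 + ('i * e%:C) *: A) (Num.sqrt (1 + (e * a) ^+ 2)).
Proof.
move=> a0 hA Aa v.
set z := 'i * e%:C.
have cz : Num.conj z = - z.
  by rewrite -[Num.conj z]/(conjc z) /z; simpc.
have zz : z * z = - (e ^+ 2)%:C.
  by rewrite /z mulrACA -expr2 sqr_i -realCM mulN1r -expr2.
have sq : vnorm ((1 + z *: A) *m v) ^+ 2 = vnorm v ^+ 2 + e ^+ 2 * vnorm (A *m v) ^+ 2.
  apply: (@complexI R); rewrite realCD (realCM (e ^+ 2)).
  transitivity (dotc v v + (e ^+ 2)%:C * dotc (A *m v) (A *m v)); last by rewrite !dotcvv.
  transitivity (dotc ((1 + z *: A) *m v) ((1 + z *: A) *m v)); first by rewrite dotcvv.
  rewrite mulmxDl mul1mx -scalemxAl.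
  have AA : dotc (A *m v) v = dotc v (A *m v) by rewrite dotcA hA.
  move: AA; set w := A *m v => AA.
  have -> : dotc (v + z *: w) (v + z *: w) =
      dotc v v + z * (dotc v w - dotc w v) - (z * z) * dotc w w.
    rewrite !dotcE -sumrB !mulr_sumr -big_split -sumrB /=; apply: eq_bigr => i _.
    by rewrite !mxE rmorphD rmorphM /= cz; ring.
  by rewrite AA subrr mulr0 addr0 zz mulNr opprK.
rewrite -ler_sqr ?nnegrE ?mulr_ge0 ?vnorm_ge0 ?sqrtr_ge0// exprMn sq.
rewrite (@sqr_sqrtr _ (1 + _)) ?addr_ge0 ?sqr_ge0// mulrDl mul1r lerD2l exprMn -[leRHS]mulrA.
by rewrite ler_wpM2l ?sqr_ge0// -exprMn ler_sqr ?nnegrE ?mulr_ge0 ?vnorm_ge0.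
Qed.

End Vec.
End VectorNorm.

(** * First- and second-order differences of matrix powers *)

Section Powers.
Context {R : realType} {n : nat}.
Local Notation C := R[i].
Implicit Types (U W Y : 'M[C]_n).

(* The part of [(W + Y) ^+ k] of degree one in [Y]. *)
Fixpoint dpow W Y k : 'M[C]_n :=
  if k is k'.+1 then dpow W Y k' * W + W ^+ k' * Y else 0.

Lemma dpowZ W (s : C) Y k : dpow W (s *: Y) k = s *: dpow W Y k.
Proof.
elim: k => [|k IH] /=; first by rewrite scaler0.
by rewrite IH scalerDr -!mulmxE scalemxAl scalemxAr.
Qed.

(** Telescoping: each of the [k] places where [U] is exchanged for [W] costs [y]. As [1 <= r], the
    missing power of [r] may be restored. *)
Lemma mxbound_subX U W (r y : R) k : 1 <= r -> 0 <= y ->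
  mxbound U r -> mxbound W r -> mxbound (U - W) y ->
  mxbound (U ^+ k - W ^+ k) (k%:R * y * r ^+ k).
Proof.
move=> r1 y0 Ur Wr UWy; have r0 : 0 <= r by apply: le_trans r1.
elim: k => [|k IH].
  by rewrite !expr0 subrr !mul0r; exact: mxbound0.
have -> : U ^+ k.+1 - W ^+ k.+1 = (U ^+ k - W ^+ k) * U + W ^+ k * (U - W).
  by rewrite !exprSr mulrBl mulrBr addrA subrK.
have H := mxboundD _ _ _ _ (mxboundM _ _ _ _ _ IH Ur) (mxboundM _ _ _ _ _ (mxboundX _ _ k r0 Wr) UWy).
apply: mxbound_le (H _ _); rewrite ?mulr_ge0 ?exprn_ge0//.
set z := r ^+ k; rewrite -natr1 exprSr -/z -subr_ge0.
have -> : (k%:R + 1) * y * (z * r) - (k%:R * y * z * r + z * y) = y * (z * r - z) by ring.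
by rewrite mulr_ge0// subr_ge0 ler_peMr// exprn_ge0.
Qed.

(** The remainder at [k.+1] is the one at [k] times [W], plus [(U ^+ k - W ^+ k) * (U - W)], which
    is of size [k y^2]. These contributions add up to less than [(k y)^2]. *)
Lemma mxbound_subX_dpow U W (r y : R) k : 1 <= r -> 0 <= y ->
  mxbound U r -> mxbound W r -> mxbound (U - W) y ->
  mxbound (U ^+ k - W ^+ k - dpow W (U - W) k) ((k%:R * y) ^+ 2 * r ^+ k).
Proof.
move=> r1 y0 Ur Wr UWy; have r0 : 0 <= r by apply: le_trans r1.
elim: k => [|k IH].
  by rewrite !expr0 /= !subr0 subrr mul0r expr0n mul0r; exact: mxbound0.
have -> : U ^+ k.+1 - W ^+ k.+1 - dpow W (U - W) k.+1 =
    (U ^+ k - W ^+ k) * (U - W) + (U ^+ k - W ^+ k - dpow W (U - W) k) * W.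
  rewrite /= !exprSr; set D := dpow W (U - W) k.
  rewrite [(_ - D) * W]mulrBl [RHS]addrA -mulrDr subrK mulrBl.
  by rewrite (addrC (D * W)) opprD addrA mulrBr opprB addrA subrK.
have H := mxboundD _ _ _ _ (mxboundM _ _ _ _ _ (mxbound_subX _ _ _ _ k r1 y0 Ur Wr UWy) UWy)
  (mxboundM _ _ _ _ _ IH Wr).
apply: mxbound_le (H _ _); rewrite ?mulr_ge0 ?exprn_ge0 ?mulr_ge0//.
have rk : 0 <= r ^+ k by exact: exprn_ge0.
have k0 : 0 <= k%:R :> R by [].
set z := r ^+ k in rk *.
rewrite -natr1 (exprSr r) -/z.
have zr : z <= z * r by rewrite ler_peMr.
have yz : 0 <= k%:R * y ^+ 2 * (z * r - z).
  by rewrite mulr_ge0 ?mulr_ge0 ?sqr_ge0// subr_ge0.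
have yz' : 0 <= (k%:R + 1) * y ^+ 2 * (z * r).
  by rewrite mulr_ge0 ?mulr_ge0 ?addr_ge0 ?sqr_ge0// (le_trans rk).
rewrite -subr_ge0.
have -> : ((k%:R + 1) * y) ^+ 2 * (z * r) - (k%:R * y * z * y + (k%:R * y) ^+ 2 * z * r)
  = k%:R * y ^+ 2 * (z * r - z) + (k%:R + 1) * y ^+ 2 * (z * r) by ring.
exact: addr_ge0.
Qed.
End Powers.

Section Trace.
Context {R : realType} {n : nat}.
Local Notation C := R[i].

(** By the spectral theorem the trace is a convex combination of the numbers [<v i, X v i>] over
    orthonormal eigenvectors of [rho], with the eigenvalues as weights; Cauchy-Schwarz bounds each
    by [c]. *)
Lemma cmod_trace_density (rho X : 'M[C]_n) (c : R) :
  density_matrix rho -> mxbound X c -> cmod (\tr (rho *m X)) <= c.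
Proof.
move=> [[hrho rho0] tr1] Xc.
have nrho : rho \is normalmx.
  apply/normalmxP.
  have -> : (rho ^t* )%sesqui = rho.
    by rewrite -[RHS]hrho /adjm map_trmx.
  by [].
have /orthomx_spectralP := nrho.
set Pm := spectralmx rho; set d := spectral_diag rho.
have uP : Pm \is unitarymx by exact: spectral_unitarymx.
have PP : Pm *m adjm Pm = 1%:M.
  by have /unitarymxP := uP; rewrite /adjm map_trmx.
rewrite invmx_unitary// (_ : (Pm ^t* )%sesqui = adjm Pm); last by rewrite /adjm map_trmx.
move=> rhoE.
pose v i : 'cV[C]_n := adjm Pm *m delta_mx i 0.
have vadj i : adjm (v i) = delta_mx 0 i *m Pm.
  rewrite adjmM adjmK; congr (_ *m _).
  by apply/matrixP => k l; rewrite !mxE andbC rmorph_nat.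
have entry (Y : 'M[C]_n) i : dotc (v i) (Y *m v i) = (Pm *m Y *m adjm Pm) i i.
  rewrite /dotc vadj /v !mulmxA -colE -!mulmxA -rowE !mxE; apply: eq_bigr => k _.
  by rewrite mxE.
have dE i : d 0 i = dotc (v i) (rho *m v i).
  rewrite entry rhoE !mulmxA PP mul1mx -mulmxA PP mulmx1.
  by rewrite mxE eqxx mulr1n.
have d0 i : 0 <= d 0 i.
  by rewrite dE /dotc mulmxA; exact: rho0.
have nv i : vnorm (v i) = 1.
  have := dotcvv (v i).
  rewrite -{2}[v i]mul1mx entry mulmx1 PP mxE eqxx => /esym/(@complexI R)/eqP.
  by rewrite sqrp_eq1 ?vnorm_ge0// => /eqP.
have trE (Y : 'M[C]_n) : \tr (rho *m Y) = \sum_i d 0 i * dotc (v i) (Y *m v i).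
  rewrite rhoE -!mulmxA mxtrace_mulC /mxtrace; apply: eq_bigr => i _.
  by rewrite entry -!mulmxA mul_diag_mx mxE !mulmxA.
have sumd : \sum_i d 0 i = 1.
  rewrite -tr1 -[rho in RHS]mulmx1 trE; apply: eq_bigr => i _.
  by rewrite entry mulmx1 PP mxE eqxx mulr1.
rewrite trE -lecR -cmodE (le_trans (ler_norm_sum _ _ _))//.
apply: (@le_trans _ _ (\sum_i d 0 i * c%:C)); last by rewrite -mulr_suml sumd mul1r.
apply: ler_sum => i _; rewrite normrM ger0_norm// ler_wpM2l// cmodE lecR.
by rewrite (le_trans (cmod_dotc _ _))// nv mul1r (le_trans (Xc _))// nv mulr1.
Qed.
End Trace.

(** * The matrix exponential as a limit of powers *)

Section ComplexLimit.
Context {R : realType}.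
Local Notation C := R[i].
Local Open Scope classical_set_scope.
Implicit Types (u v : nat -> C) (l m : C).

Lemma ReD (z w : C) : complex.Re (z + w) = complex.Re z + complex.Re w.
Proof. by case: z; case: w. Qed.

Lemma ImD (z w : C) : complex.Im (z + w) = complex.Im z + complex.Im w.
Proof. by case: z; case: w. Qed.

Lemma ReB (z w : C) : complex.Re (z - w) = complex.Re z - complex.Re w.
Proof. by case: z; case: w. Qed.

Lemma ImB (z w : C) : complex.Im (z - w) = complex.Im z - complex.Im w.
Proof. by case: z; case: w. Qed.

Lemma Re_sum (I : Type) (s : seq I) (P : pred I) (F : I -> C) :
  complex.Re (\sum_(i <- s | P i) F i) = \sum_(i <- s | P i) complex.Re (F i).
Proof. exact: (big_morph _ ReD (erefl : complex.Re (0 : C) = 0)). Qed.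

Lemma Im_sum (I : Type) (s : seq I) (P : pred I) (F : I -> C) :
  complex.Im (\sum_(i <- s | P i) F i) = \sum_(i <- s | P i) complex.Im (F i).
Proof. exact: (big_morph _ ImD (erefl : complex.Im (0 : C) = 0)). Qed.

Lemma ReZ (a : R) (z : C) : complex.Re (a%:C * z) = a * complex.Re z.
Proof. by case: z => x y /=; rewrite mul0r subr0. Qed.

Lemma ImZ (a : R) (z : C) : complex.Im (a%:C * z) = a * complex.Im z.
Proof. by case: z => x y /=; rewrite mul0r addr0. Qed.

(** Componentwise, to match [mexp], whose entries are built from separate limits of real and
    imaginary parts. *)
Definition cvgC u l : Prop :=
  (complex.Re (u k) @[k --> \oo] --> complex.Re l) /\
  (complex.Im (u k) @[k --> \oo] --> complex.Im l).

Lemma cvgC_cst l : cvgC (fun=> l) l.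
Proof. by split; exact: cvg_cst. Qed.

Lemma cvgCB {u v l m} : cvgC u l -> cvgC v m -> cvgC (fun k => u k - v k) (l - m).
Proof.
move=> [u1 u2] [v1 v2]; split.
  by rewrite ReB; under eq_fun do rewrite ReB; exact: cvgB.
by rewrite ImB; under eq_fun do rewrite ImB; exact: cvgB.
Qed.

Lemma cvgCM {u v l m} : cvgC u l -> cvgC v m -> cvgC (fun k => u k * v k) (l * m).
Proof.
have ReM (z w : C) : complex.Re (z * w) =
    complex.Re z * complex.Re w - complex.Im z * complex.Im w by case: z; case: w.
have ImM (z w : C) : complex.Im (z * w) =
    complex.Re z * complex.Im w + complex.Im z * complex.Re w by case: z; case: w.
move=> [u1 u2] [v1 v2]; split.
  by rewrite ReM; under eq_fun do rewrite ReM; apply: cvgB; exact: cvgM.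
by rewrite ImM; under eq_fun do rewrite ImM; apply: cvgD; exact: cvgM.
Qed.

Lemma cvgCD {u v l m} : cvgC u l -> cvgC v m -> cvgC (fun k => u k + v k) (l + m).
Proof.
move=> [u1 u2] [v1 v2]; split.
  by rewrite ReD; under eq_fun do rewrite ReD; exact: cvgD.
by rewrite ImD; under eq_fun do rewrite ImD; exact: cvgD.
Qed.

Lemma cvgC_sum (I : Type) (s : seq I) (F : I -> nat -> C) (L : I -> C) :
  (forall i, cvgC (F i) (L i)) -> cvgC (fun k => \sum_(i <- s) F i k) (\sum_(i <- s) L i).
Proof.
move=> FL; elim: s => [|i s IH].
  by under eq_fun do rewrite big_nil; rewrite big_nil; exact: cvgC_cst.
by under eq_fun do rewrite big_cons; rewrite big_cons; exact: cvgCD.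
Qed.

Lemma cvgC_cmod u l : cvgC u l -> cmod (u k) @[k --> \oo] --> cmod l.
Proof.
move=> [u1 u2]; rewrite /cmod; apply: continuous_cvg.
  exact: sqrt_continuous.
by rewrite /cabs2; apply: cvgD; under eq_fun do rewrite expr2; rewrite expr2; exact: cvgM.
Qed.

Lemma cvgC_close u v l (e : nat -> R) : cvgC u l ->
  (forall k, cmod (v k - u k) <= e k) -> e @ \oo --> (0 : R) -> cvgC v l.
Proof.
move=> [u1 u2] vue e0.
have key (a b : nat -> R) (c : R) : a @ \oo --> c ->
    (forall k, `|b k - a k| <= e k) -> b @ \oo --> c.
  move=> ac bae; rewrite (_ : b = (fun k => a k + (b k - a k))); last first.
    by apply/funext => k; rewrite addrC subrK.
  rewrite -[c]addr0; apply: cvgD => //.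
  apply: (@squeeze_cvgr _ _ _ _ (fun k => - e k) e) => //.
    by near=> k; rewrite -ler_norml.
  by rewrite -oppr0; exact: cvgN.
split; [apply: key u1 _ => k; rewrite -ReB|apply: key u2 _ => k; rewrite -ImB].
  exact: le_trans (Re_le_cmod _) (vue k).
exact: le_trans (Im_le_cmod _) (vue k).
Unshelve. all: by end_near. Qed.

End ComplexLimit.

(** * Scalar comparison of the exponential with compound powers *)

Section RealExp.
Context {R : realType}.
Local Open Scope classical_set_scope.

Lemma sum_exp_coeff_le (x : R) K : 0 <= x ->
  \sum_(0 <= k < K) x ^+ k / k`!%:R <= expR x.
Proof.
move=> x0; apply: (@nondecreasing_cvgn_le R (series (exp_coeff x))); last first.
  exact: is_cvg_series_exp_coeff.
by apply: nondecreasing_series => k _ _; rewrite exp_coeff_ge0.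
Qed.

(** With [y = x / n.+1], take inverses in [1 - y / (1 + y) <= exp (- y / (1 + y))], whose left side
    is [1 / (1 + y)], and raise to the power [n.+1]. *)
Lemma expR_le_compound (x : R) n : 0 <= x ->
  expR (x / (1 + x / n.+1%:R)) <= (1 + x / n.+1%:R) ^+ n.+1.
Proof.
move=> x0; set N := n.+1%:R; set y := x / N.
have y0 : 0 <= y by rewrite divr_ge0.
have y1 : 0 < 1 + y by rewrite ltr_wpDr.
have -> : x / (1 + y) = n.+1%:R * (y / (1 + y)).
  by rewrite mulrA (mulrC _ y) -/N /y divfK// pnatr_eq0.
rewrite expRM_natl lerXn2r ?nnegrE ?expR_ge0 ?(ltW y1)//.
rewrite -[leRHS]invrK -[leLHS]invrK lef_pV2 ?posrE ?invr_gt0 ?expR_gt0//.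
rewrite -expRN (le_trans _ (expR_ge1Dx _))// le_eqVlt; apply/orP; left.
by apply/eqP; field; rewrite gt_eqF.
Qed.

Lemma compound_gap (x : R) : 0 <= x ->
  (expR x - expR (x / (1 + x / n.+1%:R))) @[n --> \oo] --> 0.
Proof.
move=> x0; rewrite -(subrr (expR x)); apply: cvgB; first exact: cvg_cst.
apply: continuous_cvg; first exact: continuous_expR.
rewrite -[X in _ --> X]divr1 -[X in _ / X]addr0 -(mulr0 x).
apply: cvgM; first exact: cvg_cst.
apply: cvgV; first by rewrite mulr0 addr0 oner_eq0.
apply: cvgD; first exact: cvg_cst.
apply: cvgM; first exact: cvg_cst.
exact: cvg_harmonic.
Qed.

Lemma ffact_le_exp n k : (n ^_ k <= n ^ k)%N.
Proof.
elim: k => [|k IH]; first by rewrite ffactn0.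
by rewrite ffactnSr expnSr leq_mul// leq_subr.
Qed.

Lemma bin_div_le n k : 'C(n, k)%:R / n%:R ^+ k <= k`!%:R^-1 :> R.
Proof.
have [->|n0] := posnP n.
  by case: k => [|k]; rewrite ?bin0 ?expr0 ?invr1 ?mul1r// bin0n mul0r invr_ge0.
rewrite ler_pdivrMr ?exprn_gt0 ?ltr0n// ler_pdivlMl ?ltr0n ?fact_gt0//.
by rewrite mulrC -natrM -natrX ler_nat bin_ffact ffact_le_exp.
Qed.

End RealExp.

Section MatrixExp.
Context {R : realType} {n : nat}.
Local Notation C := R[i].
Local Open Scope classical_set_scope.
Implicit Types X : 'M[C]_n.

Definition compound X (N : nat) : 'M[C]_n := (1 + (N.+1%:R^-1)%:C *: X) ^+ N.+1.

Lemma exp_partial_entry X K i j : exp_partial X K i j =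
  \sum_(0 <= k < K) (k`!%:R^-1)%:C * (X ^+ k) i j.
Proof.
rewrite /exp_partial summxE big_mkord; apply: eq_bigr => k _.
by rewrite mxE fmorphV /= rmorph_nat.
Qed.

Lemma cvgC_exp_partial X x i j : 0 <= x -> mxbound X x ->
  cvgC (fun K => exp_partial X K i j) (mexp X i j).
Proof.
move=> x0 Xx; rewrite /cvgC mxE /=.
(* Stated for any [f] dominated by the modulus, to serve both the real and the imaginary part; the
   scalar exponential series of [x] dominates. *)
have key (f : C -> R) (u := fun k => k`!%:R^-1 * f ((X ^+ k) i j)) :
    (forall z, `|f z| <= cmod z) -> cvgn (series u).
  move=> fle; apply: normed_cvg; apply: series_le_cvg (is_cvg_series_exp_coeff x) => k.
  - exact: normr_ge0.
  - exact: exp_coeff_ge0.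
  - rewrite /= /u normrM ger0_norm ?invr_ge0// /exp_coeff /= mulrC ler_wpM2r ?invr_ge0//.
    by rewrite (le_trans (fle _))//; apply: mxbound_entry; exact: mxboundX.
split.
  rewrite (_ : (fun K => complex.Re _) = series (fun k => k`!%:R^-1 * complex.Re ((X ^+ k) i j))).
    exact: (key (@complex.Re R) Re_le_cmod).
  by apply/funext => K; rewrite exp_partial_entry Re_sum; apply: eq_bigr => k _; rewrite ReZ.
rewrite (_ : (fun K => complex.Im _) = series (fun k => k`!%:R^-1 * complex.Im ((X ^+ k) i j))).
  exact: (key (@complex.Im R) Im_le_cmod).
by apply/funext => K; rewrite exp_partial_entry Im_sum; apply: eq_bigr => k _; rewrite ImZ.
Qed.

Lemma mxexpZ (c : C) X k : (c *: X) ^+ k = c ^+ k *: X ^+ k.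
Proof.
elim: k => [|k IH]; first by rewrite !expr0 scale1r.
by rewrite !exprS IH -!mulmxE -scalemxAl -scalemxAr scalerA.
Qed.

(** Each coefficient [C(n, k) / n^k] of the compound power is at most [1 / k!]. The differences
    being nonnegative, the error in an entry is at most the same error for the scalar [x], which
    tends to 0. *)
Lemma cvgC_compound X i j : cvgC (fun N => compound X N i j) (mexp X i j).
Proof.
have [x x0 Xx] := mxbound_exists X.
have [c1 c2] := cvgC_exp_partial X x i j x0 Xx.
(* A power with exponent [N.+1] has degrees 0 to [N.+1], hence the partial sum with [N.+2] terms. *)
have c : cvgC (fun N => exp_partial X N.+2 i j) (mexp X i j).
  split.
    by move: c1; rewrite -(cvg_shiftn 2) /=; under eq_fun do rewrite addn2.
  by move: c2; rewrite -(cvg_shiftn 2) /=; under eq_fun do rewrite addn2.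
apply: cvgC_close c _ (compound_gap x x0) => N.
have -> : compound X N i j = \sum_(0 <= k < N.+2) ('C(N.+1, k)%:R / N.+1%:R ^+ k)%:C * (X ^+ k) i j.
  rewrite /compound addrC exprD1n summxE big_mkord; apply: eq_bigr => k _.
  rewrite -scaler_nat mxexpZ 2!mxE mulrA; congr (_ * _).
  rewrite -exprVn realCM; congr (_ * _); apply/esym.
    exact: (rmorph_nat (real_complex R)).
  exact: (rmorphXn (real_complex R)).
rewrite exp_partial_entry -sumrB (le_trans (cmod_sum _ _ _ _))//.
apply: (@le_trans _ _ (\sum_(0 <= k < N.+2) (k`!%:R^-1 - 'C(N.+1, k)%:R / N.+1%:R ^+ k) * x ^+ k)).
  apply: ler_sum => k _.
  rewrite -mulrBl cmodM -rmorphB cmod_real distrC ger0_norm ?subr_ge0 ?bin_div_le//.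
  rewrite ler_wpM2l ?subr_ge0 ?bin_div_le//.
  by apply: mxbound_entry; exact: mxboundX.
under eq_bigr do rewrite mulrBl.
rewrite sumrB lerB//.
  under eq_bigr do rewrite mulrC.
  exact: sum_exp_coeff_le.
apply: le_trans (expR_le_compound x N x0) _.
rewrite addrC exprD1n big_mkord le_eqVlt; apply/orP; left; apply/eqP.
apply: eq_bigr => k _.
by rewrite -mulr_natr expr_div_n; ring.
Qed.

End MatrixExp.

(** * Perturbation of the time evolution *)

Section Sandwich.
Context {R : realType} {n : nat}.
Local Notation C := R[i].

Lemma mxboundM3 (A B D : 'M[C]_n) a b d : 0 <= a -> 0 <= b ->
  mxbound A a -> mxbound B b -> mxbound D d -> mxbound (A * B * D) (a * b * d).
Proof.
move=> a0 b0 Aa Bb Dd; apply: mxboundM; rewrite ?mulr_ge0//.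
exact: mxboundM.
Qed.

(** Here [d] and [d'] are the linear parts of [u - w] and [u' - w']. Three second-order terms
    remain: a remainder on each side and the product of the two differences. *)
Lemma sandwich_expansion (O u w d u' w' d' : 'M[C]_n) :
  u * O * u' - w * O * w' - (d * O * w' + w * O * d') =
  (u - w - d) * O * w' + w * O * (u' - w' - d') + (u - w) * O * (u' - w').
Proof.
have key a a' : (w + a) * O * (w' + a') - w * O * w' - (d * O * w' + w * O * d') =
    (a - d) * O * w' + w * O * (a' - d') + a * O * a'.
  rewrite !mulrDl !mulrDr !mulNr !mulrN.
  set x0 := w * O * w'; set x1 := w * O * a'; set x2 := a * O * w'.
  set x3 := a * O * a'; set x4 := d * O * w'; set x5 := w * O * d'.
  rewrite -(addrA x0) [x0 + _]addrC addrK opprD.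
  by rewrite (AC ((1*2)*2) (((2*4)*(1*5))*3)).
by rewrite -key !(addrC w) !(addrC w') !subrK.
Qed.

Lemma sandwich_sub (O u w u' w' : 'M[C]_n) :
  u * O * u' - w * O * w' = (u - w) * O * u' + w * O * (u' - w').
Proof. by rewrite mulrBr !mulrBl addrA subrK. Qed.

Lemma dpow_sandwichZ (O w y w' y' : 'M[C]_n) (q : C) K :
  dpow w (q *: y) K * O * w' ^+ K + w ^+ K * O * dpow w' (q *: y') K =
  q *: (dpow w y K * O * w' ^+ K + w ^+ K * O * dpow w' y' K).
Proof. by rewrite !dpowZ scalerDr -!mulmxE -!scalemxAl -scalemxAr. Qed.

Lemma trace_mulmx_subZ (rho X Y Z : 'M[C]_n) (q : C) :
  \tr (rho *m X) - \tr (rho *m Y) - q * \tr (rho *m Z) = \tr (rho *m (X - Y - q *: Z)).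
Proof. by rewrite !mulmxBr !raddfB /= -scalemxAr mxtraceZ. Qed.

Variables (O u w u' w' : 'M[C]_n) (o r y : R) (K : nat).
Hypotheses (o0 : 0 <= o) (r1 : 1 <= r) (y0 : 0 <= y) (Oo : mxbound O o).
Hypotheses (ur : mxbound u r) (wr : mxbound w r) (uwy : mxbound (u - w) y).
Hypotheses (ur' : mxbound u' r) (wr' : mxbound w' r) (uwy' : mxbound (u' - w') y).

Let r0 : 0 <= r. Proof. exact: le_trans r1. Qed.
Let rK : 0 <= r ^+ K. Proof. exact: exprn_ge0. Qed.

Lemma mxbound_sandwich : mxbound (u ^+ K * O * u' ^+ K) (o * (r ^+ 2) ^+ K).
Proof.
apply: mxbound_le (mxboundM3 _ _ _ _ _ _ rK o0 (mxboundX _ _ K r0 ur) Oo (mxboundX _ _ K r0 ur')).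
by rewrite -exprM mulnC exprM expr2 mulrCA mulrA.
Qed.

Lemma mxbound_sandwich_sub :
  mxbound (u ^+ K * O * u' ^+ K - w ^+ K * O * w' ^+ K)
          (2 * (K%:R * y) * (o * (r ^+ 2) ^+ K)).
Proof.
rewrite sandwich_sub.
have yK : 0 <= K%:R * y * r ^+ K by rewrite !mulr_ge0.
have := mxboundD _ _ _ _
  (mxboundM3 _ _ _ _ _ _ yK o0 (mxbound_subX _ _ _ _ K r1 y0 ur wr uwy) Oo (mxboundX _ _ K r0 ur'))
  (mxboundM3 _ _ _ _ _ _ rK o0 (mxboundX _ _ K r0 wr) Oo (mxbound_subX _ _ _ _ K r1 y0 ur' wr' uwy')).
apply: mxbound_le; rewrite -exprM mulnC exprM expr2 le_eqVlt; apply/orP; left.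
by apply/eqP; ring.
Qed.

Lemma mxbound_sandwich_expansion :
  mxbound (u ^+ K * O * u' ^+ K - w ^+ K * O * w' ^+ K -
           (dpow w (u - w) K * O * w' ^+ K + w ^+ K * O * dpow w' (u' - w') K))
          (3 * (K%:R * y) ^+ 2 * (o * (r ^+ 2) ^+ K)).
Proof.
rewrite sandwich_expansion.
have yK : 0 <= K%:R * y * r ^+ K by rewrite !mulr_ge0.
have yK2 : 0 <= (K%:R * y) ^+ 2 * r ^+ K by rewrite mulr_ge0 ?sqr_ge0.
have := mxboundD _ _ _ _ (mxboundD _ _ _ _
  (mxboundM3 _ _ _ _ _ _ yK2 o0 (mxbound_subX_dpow _ _ _ _ K r1 y0 ur wr uwy) Oo (mxboundX _ _ K r0 wr'))
  (mxboundM3 _ _ _ _ _ _ rK o0 (mxboundX _ _ K r0 wr) Oo (mxbound_subX_dpow _ _ _ _ K r1 y0 ur' wr' uwy')))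
  (mxboundM3 _ _ _ _ _ _ yK o0 (mxbound_subX _ _ _ _ K r1 y0 ur wr uwy) Oo
     (mxbound_subX _ _ _ _ K r1 y0 ur' wr' uwy')).
apply: mxbound_le; rewrite -exprM mulnC exprM expr2 le_eqVlt; apply/orP; left.
by apply/eqP; ring.
Qed.

(** By linearity of [dpow] in the perturbation, the first-order term is exactly [q] times a number
    free of [q]; this lets two increments share one slope. *)
Lemma cmod_trace_sandwich_expansion (rho E E' : 'M[C]_n) (q : C) :
  density_matrix rho -> u - w = q *: E -> u' - w' = q *: E' ->
  cmod (\tr (rho *m (u ^+ K * O * u' ^+ K)) - \tr (rho *m (w ^+ K * O * w' ^+ K)) -
    q * \tr (rho *m (dpow w E K * O * w' ^+ K + w ^+ K * O * dpow w' E' K)))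
  <= 3 * (K%:R * y) ^+ 2 * (o * (r ^+ 2) ^+ K).
Proof.
move=> rhoD uwE uwE'; rewrite trace_mulmx_subZ -dpow_sandwichZ -uwE -uwE'.
exact: cmod_trace_density _ _ _ rhoD mxbound_sandwich_expansion.
Qed.

End Sandwich.

Section Hermitian.
Context {R : realType} {n : nat}.
Implicit Types A B : 'M[R[i]]_n.

Lemma hermitianD A B : is_hermitian A -> is_hermitian B -> is_hermitian (A + B).
Proof. by rewrite /is_hermitian /adjm map_mxD linearD /= => -> ->. Qed.

Lemma hermitianZ (q : R) A : is_hermitian A -> is_hermitian (q%:C *: A).
Proof.
rewrite /is_hermitian => hA; rewrite -[in RHS]hA; apply/matrixP => i j.
rewrite !mxE rmorphM /=; congr (_ * _).
by rewrite -[LHS]/(conjc q%:C) conjc_real.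
Qed.

Lemma hermitian_sum (I : Type) (s : seq I) (F : I -> 'M[R[i]]_n) :
  (forall i, is_hermitian (F i)) -> is_hermitian (\sum_(i <- s) F i).
Proof.
move=> hF; elim/big_ind: _ => [|A B|i _]; [|exact: hermitianD|exact: hF].
by apply/matrixP => i j; rewrite !mxE rmorph0.
Qed.

End Hermitian.

(** * Stability and second-order expansion of one evolved expectation value *)

Section Evolution.
Context {R : realType} {n : nat}.
Local Notation C := R[i].
Variables (rho O : 'M[C]_n) (T : R).
Hypotheses (rhoD : density_matrix rho) (T0 : 0 <= T).
Local Notation o := (opnorm O).

Definition evol (A : 'M[C]_n) : C := \tr (rho *m heis A O T).

(** One Euler step of [exp (i e A)]; the backward evolution uses [- e]. *)
Definition step (e : R) (A : 'M[C]_n) : 'M[C]_n := 1 + ('i * e%:C) *: A.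

Definition evol_approx (A : 'M[C]_n) (N : nat) : C :=
  \tr (rho *m (step (T / N.+1%:R) A ^+ N.+1 * O * step (- (T / N.+1%:R)) A ^+ N.+1)).

Lemma compound_step (e : R) A N :
  compound (('i * e%:C) *: A) N = step (e / N.+1%:R) A ^+ N.+1.
Proof.
by rewrite /compound /step scalerA mulrCA -realCM (mulrC _ e).
Qed.

Lemma cvgC_mulmx (X Y : nat -> 'M[C]_n) (X' Y' : 'M[C]_n) :
  (forall i j, cvgC (fun N => X N i j) (X' i j)) ->
  (forall i j, cvgC (fun N => Y N i j) (Y' i j)) ->
  forall i j, cvgC (fun N => (X N *m Y N) i j) ((X' *m Y') i j).
Proof.
move=> XX YY i j; rewrite mxE; under [fun N => _]eq_fun do rewrite mxE.
by apply: cvgC_sum => k; exact: cvgCM.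
Qed.

Lemma cvgC_evol A : cvgC (evol_approx A) (evol A).
Proof.
apply: cvgC_sum => k; apply: cvgC_mulmx => [i j|]; first exact: cvgC_cst.
rewrite /heis; have -> : - ('i * T%:C) = 'i * (- T)%:C by rewrite rmorphN mulrN.
apply: cvgC_mulmx => [|i j]; last first.
  by under eq_fun do rewrite -mulNr -compound_step; exact: cvgC_compound.
apply: cvgC_mulmx => i j; last exact: cvgC_cst.
by under eq_fun do rewrite -compound_step; exact: cvgC_compound.
Qed.

Local Open Scope classical_set_scope.
Lemma cmod_cvgC_le (u : nat -> C) l (c x : R) : cvgC u l ->
  (forall N, cmod (u N) <= c * expR (x / N.+1%:R)) -> cmod l <= c.
Proof.
move=> /cvgC_cmod ul ux.
have : c * expR (x / N.+1%:R) @[N --> \oo] --> c * expR (x * 0).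
  apply: cvgM; first exact: cvg_cst.
  apply: continuous_cvg; first exact: continuous_expR.
  by apply: cvgM; [exact: cvg_cst|exact: cvg_harmonic].
rewrite mulr0 expR0 mulr1.
move/(ler_cvg_to ul); apply.
by near=> N; exact: ux.
Unshelve. all: by end_near. Qed.
Local Close Scope classical_set_scope.

Definition rate (a : R) (N : nat) := Num.sqrt (1 + (T / N.+1%:R * a) ^+ 2).

Lemma rate_ge1 a N : 1 <= rate a N.
Proof. by rewrite -[leLHS]sqrtr1 ler_wsqrtr// lerDl sqr_ge0. Qed.

(** The square pairs a forward step with a backward one; then apply [1 + z <= exp z] at
    [z = (T a / N.+1)^2]. *)
Lemma rate_exp a N : (rate a N ^+ 2) ^+ N.+1 <= expR ((T * a) ^+ 2 / N.+1%:R).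
Proof.
rewrite sqr_sqrtr ?addr_ge0 ?sqr_ge0//.
have -> : (T * a) ^+ 2 / N.+1%:R = N.+1%:R * (T / N.+1%:R * a) ^+ 2 by field.
by rewrite expRM_natl lerXn2r ?nnegrE ?addr_ge0 ?sqr_ge0 ?expR_ge0 ?expR_ge1Dx.
Qed.

Lemma mxbound_step A a N : 0 <= a -> is_hermitian A -> mxbound A a ->
  mxbound (step (T / N.+1%:R) A) (rate a N) /\
  mxbound (step (- (T / N.+1%:R)) A) (rate a N).
Proof.
move=> a0 hA Aa; split; first exact: mxbound_1iA.
by have := mxbound_1iA A a (- (T / N.+1%:R)) a0 hA Aa; rewrite [_ * a]mulNr sqrrN.
Qed.

Lemma step_sub (e : R) A B : step e A - step e B = ('i * e%:C) *: (A - B).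
Proof. by rewrite /step opprD addrACA subrr add0r scalerBr. Qed.

Lemma mxbound_step_sub A B b N : mxbound (A - B) b ->
  mxbound (step (T / N.+1%:R) A - step (T / N.+1%:R) B) (T / N.+1%:R * b) /\
  mxbound (step (- (T / N.+1%:R)) A - step (- (T / N.+1%:R)) B) (T / N.+1%:R * b).
Proof.
have TN : 0 <= T / N.+1%:R by rewrite divr_ge0.
move=> ABb; split; rewrite step_sub.
  by have := mxboundZ _ _ ('i * (T / N.+1%:R)%:C) ABb; rewrite cmodM cmodi mul1r cmod_real ger0_norm.
by have := mxboundZ _ _ ('i * (- (T / N.+1%:R))%:C) ABb; rewrite cmodM cmodi mul1r cmod_real normrN ger0_norm.
Qed.

Let o0 : 0 <= o. Proof. exact: opnorm_ge0. Qed.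
Let Oo : mxbound O o. Proof. exact: mxbound_opnorm. Qed.

Lemma cmod_evol_le A : is_hermitian A -> cmod (evol A) <= o.
Proof.
move=> hA; have [a a0 Aa] := mxbound_exists A.
apply: (@cmod_cvgC_le _ _ _ ((T * a) ^+ 2) (cvgC_evol A)) => N.
have [s1 s2] := mxbound_step _ _ N a0 hA Aa.
apply: le_trans (cmod_trace_density _ _ _ rhoD
  (mxbound_sandwich _ _ _ _ _ N.+1 o0 (rate_ge1 a N) Oo s1 s2)) _.
by rewrite ler_wpM2l ?rate_exp.
Qed.

Lemma cmod_evol_sub A B b : is_hermitian A -> is_hermitian B -> 0 <= b ->
  mxbound (A - B) b -> cmod (evol A - evol B) <= 2 * T * o * b.
Proof.
move=> hA hB b0 ABb.
have [a1 a10 Aa1] := mxbound_exists A; have [a2 a20 Ba2] := mxbound_exists B.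
pose a := a1 + a2; have a0 : 0 <= a by exact: addr_ge0.
have Aa : mxbound A a by apply: mxbound_le Aa1; rewrite lerDl.
have Ba : mxbound B a by apply: mxbound_le Ba2; rewrite lerDr.
have cvg : cvgC (fun N => evol_approx A N - evol_approx B N) (evol A - evol B).
  exact: cvgCB (cvgC_evol A) (cvgC_evol B).
apply: (@cmod_cvgC_le _ _ _ ((T * a) ^+ 2) cvg) => N.
have [A1 A2] := mxbound_step _ _ N a0 hA Aa.
have [B1 B2] := mxbound_step _ _ N a0 hB Ba.
have [D1 D2] := mxbound_step_sub _ _ _ N ABb.
have y0 : 0 <= T / N.+1%:R * b by rewrite mulr_ge0 ?divr_ge0.
rewrite /evol_approx -raddfB -mulmxBr.
apply: le_trans (cmod_trace_density _ _ _ rhoD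
  (mxbound_sandwich_sub _ _ _ _ _ _ _ _ N.+1 o0 (rate_ge1 a N) y0 Oo A1 B1 D1 A2 B2 D2)) _.
have -> : N.+1%:R * (T / N.+1%:R * b) = T * b by field.
rewrite (_ : 2 * T * o * b * _ = 2 * (T * b) * (o * expR ((T * a) ^+ 2 / N.+1%:R))); last by ring.
by rewrite ler_wpM2l ?mulr_ge0// ler_wpM2l ?rate_exp.
Qed.

Lemma cmod_evol_expansion A V r s : is_hermitian A -> is_hermitian V -> mxbound V 1 ->
  cmod (r%:C * (evol (A + s%:C *: V) - evol A) - s%:C * (evol (A + r%:C *: V) - evol A))
    <= 3 * T ^+ 2 * o * (`|r| * s ^+ 2 + `|s| * r ^+ 2).
Proof.
move=> hA hV V1; have [a1 a10 Aa1] := mxbound_exists A.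
(* Large enough to bound [A] and both perturbed matrices, so that a single [rate] serves all of
   them. *)
pose a := a1 + (`|r| + `|s|); have a0 : 0 <= a by rewrite !addr_ge0.
pose E N := ('i * (T / N.+1%:R)%:C) *: V.
pose E' N := ('i * (- (T / N.+1%:R))%:C) *: V.
pose W N := step (T / N.+1%:R) A; pose W' N := step (- (T / N.+1%:R)) A.
pose ell N := \tr (rho *m (dpow (W N) (E N) N.+1 * O * W' N ^+ N.+1 +
  W N ^+ N.+1 * O * dpow (W' N) (E' N) N.+1)).
have remainder q N : `|q| <= `|r| + `|s| ->
    cmod (evol_approx (A + q%:C *: V) N - evol_approx A N - q%:C * ell N) <=
    3 * (T * q) ^+ 2 * (o * expR ((T * a) ^+ 2 / N.+1%:R)).
  move=> qrs.
  have hAq : is_hermitian (A + q%:C *: V).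
    exact/hermitianD/hermitianZ.
  have qV : mxbound (q%:C *: V) `|q|.
    by have := mxboundZ _ _ q%:C V1; rewrite cmod_real mulr1.
  have Aq : mxbound (A + q%:C *: V) a.
    by apply: mxbound_le (mxboundD _ _ _ _ Aa1 qV); rewrite lerD2l.
  have Aa : mxbound A a by apply: mxbound_le Aa1; rewrite lerDl addr_ge0.
  have AqA : mxbound (A + q%:C *: V - A) `|q| by rewrite addrC addKr.
  have stepE : step (T / N.+1%:R) (A + q%:C *: V) - W N = q%:C *: E N.
    by rewrite /W step_sub addrC addKr /E !scalerA mulrC.
  have stepE' : step (- (T / N.+1%:R)) (A + q%:C *: V) - W' N = q%:C *: E' N.
    by rewrite /W' step_sub addrC addKr /E' !scalerA mulrC.
  have [A1 A2] := mxbound_step _ _ N a0 hAq Aq.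
  have [B1 B2] := mxbound_step _ _ N a0 hA Aa.
  have [D1 D2] := mxbound_step_sub _ _ _ N AqA.
  have y0 : 0 <= T / N.+1%:R * `|q| by rewrite mulr_ge0 ?divr_ge0.
  apply: le_trans (cmod_trace_sandwich_expansion _ _ _ _ _ _ _ _ N.+1
    o0 (rate_ge1 a N) y0 Oo A1 B1 D1 A2 B2 D2 _ _ _ _ rhoD stepE stepE') _.
  have -> : N.+1%:R * (T / N.+1%:R * `|q|) = T * `|q| by field.
  have -> : (T * `|q|) ^+ 2 = (T * q) ^+ 2 by rewrite !exprMn real_normK ?num_real.
  apply: ler_wpM2l; first by rewrite mulr_ge0 ?sqr_ge0.
  by apply: ler_wpM2l => //; exact: rate_exp.
pose f N q := evol_approx (A + q%:C *: V) N - evol_approx A N.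
have cvgf q : cvgC (fun N => f N q) (evol (A + q%:C *: V) - evol A).
  exact: cvgCB (cvgC_evol _) (cvgC_evol _).
have cvg : cvgC (fun N => r%:C * f N s - s%:C * f N r)
  (r%:C * (evol (A + s%:C *: V) - evol A) - s%:C * (evol (A + r%:C *: V) - evol A)).
  by apply: cvgCB; apply: cvgCM (cvgC_cst _) (cvgf _).
apply: (@cmod_cvgC_le _ _ _ ((T * a) ^+ 2) cvg) => N.
(* The products [r * s * ell N] cancel, leaving [r] times the remainder at [s] minus [s] times the
   remainder at [r]. *)
have split_slope (p q x y l : C) : p * x - q * y = p * (x - q * l) - q * (y - p * l).
  by ring.
rewrite [X in cmod X](split_slope _ _ _ _ (ell N)).
apply: le_trans (cmodB _ _) _; rewrite !cmodM !cmod_real.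
have regroup (p q x y T' o' e : R) :
    p * (3 * (T' * y) ^+ 2 * (o' * e)) + q * (3 * (T' * x) ^+ 2 * (o' * e)) =
    3 * T' ^+ 2 * o' * (p * y ^+ 2 + q * x ^+ 2) * e by ring.
rewrite -[leRHS]regroup; apply: lerD; apply: ler_wpM2l => //; apply: remainder.
  by rewrite lerDr.
by rewrite lerDl.
Qed.

End Evolution.

(** * The disordered Hamiltonian *)

Section Disorder.
Context {R : realType} {n M : nat}.
Local Notation C := R[i].
Variables (rho O H : 'M[C]_n) (V : 'I_M -> 'M[C]_n) (T : R).
Hypotheses (rhoD : density_matrix rho) (T0 : 0 <= T) (hH : is_hermitian H).
Hypotheses (hV : forall m, is_hermitian (V m)) (V1 : forall m, mxbound (V m) 1).

Definition disordered (g : 'I_M -> R) : 'M[C]_n := H + \sum_(m < M) (g m)%:C *: V m.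

Lemma disordered_hermitian g : is_hermitian (disordered g).
Proof. by apply: hermitianD => //; apply: hermitian_sum => m; exact: hermitianZ. Qed.

Lemma disordered_sub g g' :
  mxbound (disordered g - disordered g') (\sum_m `|g m - g' m|).
Proof.
rewrite /disordered opprD addrACA subrr add0r -sumrB; apply: mxbound_sum => m.
rewrite -scalerBl -rmorphB /=.
by have := mxboundZ _ _ (g m - g' m)%:C (V1 m); rewrite cmod_real mulr1.
Qed.

Lemma disordered_upd g j s :
  disordered (upd g j s) = disordered (upd g j 0) + s%:C *: V j.
Proof.
rewrite /disordered -addrA; congr (_ + _).
rewrite (bigD1 j)// [in RHS](bigD1 j)//= /upd eqxx scale0r add0r addrC; congr (_ + _).
by apply: eq_bigr => m /negbTE ->.
Qed.

(** The averages are real integrals, so the complex trace is seen through a real-linear [f]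
    dominated by the modulus, to be taken as [Re] and [Im]. Real-linearity lets [f] commute with the
    slope-free combination. *)
Lemma gauss_expect_evol (chi : 'I_M -> R -> R) (delta : R) (f : C -> R) :
  (forall z w, f (z - w) = f z - f w) -> (forall q z, f (q%:C * z) = q * f z) ->
  (forall z, `|f z| <= cmod z) -> 0 <= delta ->
  (forall j x y, `|chi j x - chi j y| <= delta * `|x - y|) ->
  (forall j, chi j 0 = 0) -> (forall j, gauss_mean (chi j) = 0) ->
  `|gauss_expect (fun th => f (evol rho O T (disordered (fun j => chi j (th j)))))
    - f (evol rho O T H)| <=
  M%:R * (3 * T ^+ 2 * opnorm O * delta ^+ 2 * gauss_mean (fun x : R => x ^+ 2)).
Proof.
move=> fB fZ fle d0 chiL chi0 Echi.
have o0 : 0 <= opnorm O by exact: opnorm_ge0.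
have -> : H = disordered (fun=> 0).
  by rewrite /disordered big1 ?addr0// => m _; rewrite scale0r.
apply: (gauss_expect_second_order _ (opnorm O) (2 * T * opnorm O) _ _ _
  (fun g => f (evol rho O T (disordered g)))) => //; rewrite ?mulr_ge0//.
- split=> [g|g g'].
    by apply: le_trans (fle _) _; apply: cmod_evol_le => //; exact: disordered_hermitian.
  rewrite -fB; apply: le_trans (fle _) _; apply: cmod_evol_sub => //.
  + exact: disordered_hermitian.
  + exact: disordered_hermitian.
  + exact: sumr_ge0.
  + exact: disordered_sub.
- have f_slope (p q : R) (x y z : C) :
      p * (f x - f z) - q * (f y - f z) = f (p%:C * (x - z) - q%:C * (y - z)).
    by rewrite fB !fZ !fB.
  move=> g j r s; rewrite f_slope; apply: le_trans (fle _) _.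
  rewrite (disordered_upd g j s) (disordered_upd g j r).
  exact: cmod_evol_expansion (disordered_hermitian _) (hV j) (V1 j).
Qed.

End Disorder.

Theorem theorem4 (R : realType) (cM K : R) (k : nat) :
  0 < cM -> 0 < K ->
  exists C : R, 0 < C /\
  forall (N M : nat) (H : 'M[R[i]]_(qdim N)) (V : 'I_M -> 'M[R[i]]_(qdim N))
         (delta : R) (Gamma : \bar R) (chi : 'I_M -> R -> R) (t : R)
         (rho O : 'M[R[i]]_(qdim N)),
    M%:R <= cM * N%:R ->
    is_hermitian H ->
    (forall m, is_hermitian (V m) /\ opnorm (V m) <= 1 /\ k_local k (V m)) ->
    0 < delta -> (0 < Gamma)%E ->
    (forall m, chi_deformation delta Gamma (chi m)) ->
    0 <= t ->
    Num.sqrt N%:R * t * delta <= K ->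
    density_matrix rho -> is_hermitian O ->
    `| gauss_expectC (fun theta : 'I_M -> R =>
           \tr (rho *m heis (H + \sum_(m < M) ((chi m (theta m))%:C *: V m)) O t))
       - \tr (rho *m heis H O t) |
      <= (C * N%:R * delta ^+ 2 * t ^+ 2 * opnorm O)%:C.
Proof.
move=> cM0 _; pose m2 := gauss_mean (fun x : R => x ^+ 2).
have m20 : 0 <= m2 by apply: Rintegral_ge0 => x _; exact: sqr_ge0.
(* The 6 is the constant 3 of the expansion, once for [Re] and once for [Im]; [cM] converts [M] into
   [N]; [1 + m2] is positive given only [0 <= m2]. *)
exists (6 * cM * (1 + m2)); split; first by rewrite !mulr_gt0// ltr_wpDr.
move=> N M H V delta Gamma chi t rho O MN hH hV d0 _ hchi t0 _ rhoD _.
have V1 m : mxbound (V m) 1 by apply: mxbound_le (hV m).2.1 (mxbound_opnorm _).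
have main := gauss_expect_evol rho O H V t rhoD t0 hH (fun m => (hV m).1) V1 chi delta.
have chiL j := chi_deformation_lipschitz delta Gamma _ (hchi j).
have chi0 j : chi j 0 = 0 by have [[]] := hchi j.
have Echi j : gauss_mean (chi j) = 0 by have [_ []] := hchi j.
have HRe := main (@complex.Re R) ReB ReZ Re_le_cmod (ltW d0) chiL chi0 Echi.
have HIm := main (@complex.Im R) ImB ImZ Im_le_cmod (ltW d0) chiL chi0 Echi.
rewrite cmodE lecR (le_trans (cmod_le_ReIm _))// ReB ImB /=.
apply: le_trans (lerD HRe HIm) _.
have o0 : 0 <= opnorm O by exact: opnorm_ge0.
pose q := t ^+ 2 * opnorm O * delta ^+ 2.
have q0 : 0 <= q by apply: mulr_ge0; [apply: mulr_ge0 => //|]; exact: sqr_ge0.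
apply: (@le_trans _ _ (M%:R * (6 * (q * m2)))).
  by rewrite le_eqVlt; apply/orP; left; apply/eqP; rewrite -/m2 /q; ring.
apply: (@le_trans _ _ (cM * N%:R * (6 * (q * (1 + m2))))).
  apply: ler_pM => //; first by rewrite mulr_ge0// mulr_ge0.
  by rewrite ler_pM2l// ler_wpM2l// lerDr.
by rewrite le_eqVlt; apply/orP; left; apply/eqP; rewrite /q; ring.
Qed.
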